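(* Let $R$ be a discrete valuation ring with uniformizer $\pi$ and residue field $\mathbb{F}=R/\pi$. Let $\mathcal{F}$ be a network sheaf on a finite graph $G$ whose stalks are finite-rank free $R$-modules, and let $d: C^0(G;\mathcal{F})\to C^1(G;\mathcal{F})$ be its coboundary, with matrix $[d]$ with respect to bases of the cochain modules. Then there exist unimodular matrices $U,V$ (invertible matrices over $R$) such that $$U\,[d]\,V=\mathrm{diag}(\pi^{a_1},\ldots,\pi^{a_r},0,\ldots,0)$$ is the Smith normal form of $d$, with $0\le a_1\le\cdots\le a_r$ and $r=\mathrm{rank}_R(d)$. For each $k\ge 0$, the digit connecting homomorphism $$\partial_k: H^0(G;\mathcal{F}/\pi^k\mathcal{F})\longrightarrow H^1(G;\mathcal{F}/\pi\mathcal{F})$$ arising from $0\to \pi^k\mathcal{F}/\pi^{k+1}\mathcal{F}\to \mathcal{F}/\pi^{k+1}\mathcal{F}\to \mathcal{F}/\pi^k\mathcal{F}\to 0$ satisfies $$\dim_{\mathbb{F}}\mathrm{im}(\partial_k)=\#\{\,j: 1\le a_j\le k\,\}.$$ Consequently, the sequence $(\dim_{\mathbb{F}}\mathrm{im}(\partial_k))_{k\ge 0}$ is nondecreasing, stabilizes at $\#\{j: a_j\ge 1\}$ (the number of torsion summands of $H^1(G;\mathcal{F})$), and the multiset $\{a_j: a_j\ge 1\}$ is determined by $$\#\{j: a_j=\ell\}=\dim_{\mathbb{F}}\mathrm{im}(\partial_\ell)-\dim_{\mathbb{F}}\mathrm{im}(\partial_{\ell-1})\quad\text{for }\ell\ge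 1.$$ Moreover, when the residue field $\mathbb{F}$ is finite, $$|H^1(G;\mathcal{F})_{\mathrm{tors}}|=(\#\mathbb{F})^{\sum_{j=1}^r a_j}.$$
   Context: A network sheaf $\mathcal{F}$ of $R$-modules on a finite graph $G=(V,E)$ assigns an $R$-module $\mathcal{F}(v)$ to each vertex, an $R$-module $\mathcal{F}(e)$ to each edge (the stalks), and an $R$-linear restriction map $\mathcal{F}_{v\to e}:\mathcal{F}(v)\to\mathcal{F}(e)$ to each incidence of a vertex $v$ with an edge $e$. Cochains: $C^0(G;\mathcal{F})=\prod_v\mathcal{F}(v)$, $C^1(G;\mathcal{F})=\prod_e\mathcal{F}(e)$. Fixing an orientation of each edge, the coboundary is $(ds)(e)=\mathcal{F}_{u\to e}(s(u))-\mathcal{F}_{v\to e}(s(v))$ for $e:u\to v$. Cohomology: $H^0=\ker d$, $H^1=\mathrm{coker}\,d=C^1/\mathrm{im}\,d$. The sheaves $\mathcal{F}/\pi^k\mathcal{F}$ and $\pi^k\mathcal{F}/\pi^{k+1}\mathcal{F}$ are formed stalkwise with induced restriction maps (so $\mathcal{F}/\pi^0\mathcal{F}=0$). Digit map: $\partial_k$ is the connecting homomorphism $H^0(G;\mathcal{F}/\pi^k\mathcal{F})\to H^1(G;\pi^k\mathcal{F}/\pi^{k+1}\mathcal{F})$ of the long exact cohomology sequence of the displayed short exact sequence, followed by the isomorphism $H^1(G;\pi^k\mathcal{F}/\pi^{k+1}\mathcal{F})\cong H^1(G;\mathcal{F}/\pi\mathcal{F})$ induced by the stalkwise isomorphism $[\pi^k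 x]\mapsto[x]$. $M_{\mathrm{tors}}$ denotes the torsion submodule of $M$. *)

(* Defs.v *)
From HB Require Import structures.
From mathcomp Require Import all_boot all_order all_algebra.
From mathcomp Require Import generic_quotient ring_quotient.
From mathcomp Require Import boolp classical_sets functions cardinality.

Set Implicit Arguments.
Unset Strict Implicit.
Unset Printing Implicit Defensive.
Import GRing.Theory.
Local Open Scope ring_scope.
Local Open Scope quotient_scope.

Record submodule (R : pzRingType) (M : lmodType R) := Submodule {
  submodule_pred :> {pred M};
  submoduleP : submod_closed submodule_pred }.

HB.instance Definition _ (R : pzRingType) (M : lmodType R) (N : submodule M) :=
  GRing.isZmodClosed.Build M (submodule_pred N) (GRing.submod_closedB (submoduleP N)).
HB.instance Definition _ (R : pzRingType) (M : lmodType R) (N : submodule M) :=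
  GRing.isScaleClosed.Build R M (submodule_pred N)
    (GRing.subsemimod_closedZ (GRing.submod_closed_semi (submoduleP N))).

Section SubQuotient.
Variables (R : pzRingType) (M : lmodType R) (N : submodule M).

Definition subm : Type := {x : M | x \in N}.
HB.instance Definition _ := SubChoice.on subm.
HB.instance Definition _ := [SubChoice_isSubLmodule of subm by <:].

Definition quom : Type := Quotient.quot N.
HB.instance Definition _ := EqQuotient.on quom.
HB.instance Definition _ := GRing.Zmodule.on quom.

Definition quom_pi (x : M) : quom := \pi_(Quotient.quot N) x.

Lemma quom_piE x y : (quom_pi x = quom_pi y) <-> (x - y \in N).
Proof.
split=> [|h].
  by move/eqP; rewrite /quom_pi -Quotient.idealrBE.
by apply/eqP; rewrite /quom_pi -Quotient.idealrBE.
Qed.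

Lemma quom_reprK (q : quom) : quom_pi (repr q) = q.
Proof. by rewrite /quom_pi reprK. Qed.

Lemma quom_piB : zmod_morphism quom_pi.
Proof. exact: (raddfB (\pi_(Quotient.quot N))). Qed.

HB.instance Definition _ :=
  GRing.isZmodMorphism.Build M quom quom_pi quom_piB.

Definition quom_scale (a : R) (q : quom) : quom := quom_pi (a *: repr q).

Lemma quom_scaleE a x : quom_scale a (quom_pi x) = quom_pi (a *: x).
Proof.
apply/quom_piE; rewrite -scalerBr; apply: rpredZ.
by apply/quom_piE; rewrite quom_reprK.
Qed.

Fact quom_scaleA a b q : quom_scale a (quom_scale b q) = quom_scale (a * b) q.
Proof. by rewrite -(quom_reprK q) !quom_scaleE scalerA. Qed.
Fact quom_scale1 : left_id 1 quom_scale.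
Proof. by move=> q; rewrite -(quom_reprK q) quom_scaleE scale1r. Qed.
Fact quom_scaleDr : right_distributive quom_scale +%R.
Proof.
move=> a p q; rewrite -(quom_reprK p) -(quom_reprK q).
by rewrite -raddfD !quom_scaleE scalerDr raddfD.
Qed.
Fact quom_scaleDl q : {morph quom_scale^~ q : a b / a + b}.
Proof.
by move=> a b; rewrite -(quom_reprK q) !quom_scaleE scalerDl raddfD.
Qed.

HB.instance Definition _ := GRing.Zmodule_isLmodule.Build R quom
  quom_scaleA quom_scale1 quom_scaleDr quom_scaleDl.

Fact quom_piZ : scalable quom_pi.
Proof. by move=> a x; rewrite -quom_scaleE. Qed.
HB.instance Definition _ := GRing.isScalable.Build R M quom *:%R quom_pi quom_piZ.

End SubQuotient.

Section Product.
Variables (R : pzRingType) (I : finType) (M : I -> lmodType R).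

Definition prodm : Type := {dffun forall i, M i}.
HB.instance Definition _ := Choice.on prodm.

Definition prodm_val (x : prodm) (i : I) : M i := (x : {dffun forall i, M i}) i.
Coercion prodm_val : prodm >-> Funclass.
Definition mkprodm (f : forall i, M i) : prodm := [ffun i => f i].

Lemma mkprodmE f i : mkprodm f i = f i.
Proof. by rewrite /prodm_val ffunE. Qed.
Lemma prodmP (x y : prodm) : (forall i, x i = y i) -> x = y.
Proof. by move=> h; apply/ffunP. Qed.

Definition prodm0 := mkprodm (fun i => 0).
Definition prodm_opp (x : prodm) := mkprodm (fun i => - x i).
Definition prodm_add (x y : prodm) := mkprodm (fun i => x i + y i).
Definition prodm_scale (a : R) (x : prodm) := mkprodm (fun i => a *: x i).

Fact prodm_addA : associative prodm_add.
Proof. by move=> x y z; apply: prodmP => i; rewrite !mkprodmE addrA. Qed.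
Fact prodm_addC : commutative prodm_add.
Proof. by move=> x y; apply: prodmP => i; rewrite !mkprodmE addrC. Qed.
Fact prodm_add0 : left_id prodm0 prodm_add.
Proof. by move=> x; apply: prodmP => i; rewrite !mkprodmE add0r. Qed.
Fact prodm_addN : left_inverse prodm0 prodm_opp prodm_add.
Proof. by move=> x; apply: prodmP => i; rewrite !mkprodmE addNr. Qed.
HB.instance Definition _ := GRing.isZmodule.Build prodm
  prodm_addA prodm_addC prodm_add0 prodm_addN.

Fact prodm_scaleA a b x : prodm_scale a (prodm_scale b x) = prodm_scale (a * b) x.
Proof. by apply: prodmP => i; rewrite !mkprodmE scalerA. Qed.
Fact prodm_scale1 : left_id 1 prodm_scale.
Proof. by move=> x; apply: prodmP => i; rewrite !mkprodmE scale1r. Qed.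
Fact prodm_scaleDr : right_distributive prodm_scale +%R.
Proof. by move=> a x y; apply: prodmP => i; rewrite !mkprodmE scalerDr. Qed.
Fact prodm_scaleDl x : {morph prodm_scale^~ x : a b / a + b}.
Proof. by move=> a b; apply: prodmP => i; rewrite !mkprodmE scalerDl. Qed.
HB.instance Definition _ := GRing.Zmodule_isLmodule.Build R prodm
  prodm_scaleA prodm_scale1 prodm_scaleDr prodm_scaleDl.

Lemma prodmDE (x y : prodm) i : (x + y) i = x i + y i.
Proof. exact: mkprodmE. Qed.
Lemma prodmZE a (x : prodm) i : (a *: x) i = a *: x i.
Proof. exact: mkprodmE. Qed.
Lemma prodm0E i : (0 : prodm) i = 0.
Proof. exact: mkprodmE. Qed.

End Product.

Section ProductMap.
Variables (R : pzRingType) (I : finType) (M M' : I -> lmodType R).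
Variable f : forall i, {linear M i -> M' i}.

Definition prodm_map (x : prodm M) : prodm M' := mkprodm (fun i => f i (x i)).

Fact prodm_map_linear : linear prodm_map.
Proof.
move=> a x y; apply: prodmP => i.
by rewrite !mkprodmE linearP.
Qed.
HB.instance Definition _ :=
  GRing.isLinear.Build R (prodm M) (prodm M') *:%R prodm_map prodm_map_linear.

End ProductMap.

Section Submodules.
Variables (R : pzRingType) (M M' : lmodType R).

Fact ker_closed (f : {linear M -> M'}) : submod_closed [pred x | f x == 0].
Proof.
split=> [|a x y]; rewrite !inE ?linear0 // => /eqP fx /eqP fy.
by rewrite linearP fx fy scaler0 addr0.
Qed.
Definition kerm f := Submodule (ker_closed f).

Fact im_closed (f : {linear M -> M'}) :
  submod_closed [pred y | `[< exists x, y = f x >]].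
Proof.
split=> [|a y z]; first by apply/asboolP; exists 0; rewrite linear0.
move=> /asboolP[u ->] /asboolP[v ->]; apply/asboolP.
by exists (a *: u + v); rewrite linearP.
Qed.
Definition imm f := Submodule (im_closed f).

Fact preim_closed (f : {linear M -> M'}) (N : submodule M') :
  submod_closed [pred x | f x \in N].
Proof.
split=> [|a x y]; rewrite !inE ?linear0 ?rpred0 // => fx fy.
by rewrite linearP rpredD // rpredZ.
Qed.
Definition preimm f N := Submodule (preim_closed f N).

End Submodules.

Section CommutativeSubmodules.
Variables (R : comPzRingType) (M : lmodType R).

Fact mult_closed (c : R) : submod_closed [pred x : M | `[< exists y, x = c *: y >]].
Proof.
split=> [|a y z]; first by apply/asboolP; exists 0; rewrite scaler0.
move=> /asboolP[u ->] /asboolP[v ->]; apply/asboolP.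
by exists (a *: u + v); rewrite scalerDr !scalerA mulrC.
Qed.
Definition multm c := Submodule (mult_closed c).

End CommutativeSubmodules.

Section Torsion.
Variables (R : idomainType) (M : lmodType R).

Fact tors_closed :
  submod_closed [pred x : M | `[< exists r : R, r != 0 /\ r *: x = 0 >]].
Proof.
split=> [|a y z].
  by apply/asboolP; exists 1; rewrite oner_neq0 scaler0.
move=> /asboolP[r [r0 ry]] /asboolP[s [s0 sz]]; apply/asboolP.
exists (r * s); split; first by rewrite mulf_neq0.
rewrite scalerDr scalerA -(scalerA r s z) sz scaler0 addr0.
by rewrite -mulrA mulrC -scalerA ry !scaler0.
Qed.
Definition torsm := Submodule tors_closed.

End Torsion.

Section InducedMaps.
Variables (R : pzRingType) (M M' : lmodType R) (f : {linear M -> M'}).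
Variables (N : submodule M) (N' : submodule M').
Hypothesis fN : forall x, x \in N -> f x \in N'.

Definition quom_map of (forall x, x \in N -> f x \in N') :=
  fun q : quom N => quom_pi N' (f (repr q)).

Lemma quom_mapE x : quom_map fN (quom_pi N x) = quom_pi N' (f x).
Proof.
apply/quom_piE; rewrite -linearB; apply: fN.
by apply/quom_piE; rewrite quom_reprK.
Qed.

Fact quom_map_linear : linear (quom_map fN).
Proof.
move=> a p q; rewrite -(quom_reprK p) -(quom_reprK q) -linearP.
by rewrite !quom_mapE linearP linearP.
Qed.
HB.instance Definition _ :=
  GRing.isLinear.Build R (quom N) (quom N') *:%R (quom_map fN) quom_map_linear.

Definition subm_map (x : subm N) : subm N' := Sub (f (val x)) (fN (valP x)).

Fact subm_map_linear : linear subm_map.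
Proof. by move=> a x y; apply: val_inj; rewrite /= !linearP. Qed.
HB.instance Definition _ :=
  GRing.isLinear.Build R (subm N) (subm N') *:%R subm_map subm_map_linear.

End InducedMaps.

Definition induced_quom (R : pzRingType) (M M' : lmodType R) (f : {linear M -> M'})
    (N : submodule M) (N' : submodule M') (fN : forall x, x \in N -> f x \in N')
  : {linear quom N -> quom N'} := quom_map fN.

Definition induced_subm (R : pzRingType) (M M' : lmodType R) (f : {linear M -> M'})
    (N : submodule M) (N' : submodule M') (fN : forall x, x \in N -> f x \in N')
  : {linear subm N -> subm N'} := subm_map fN.

Section GraphMap.
Variables (R : pzRingType) (M M' : lmodType R) (g : M -> M' -> Prop).

Record linear_graph : Prop := LinearGraph {
  graph_total : forall x, exists y, g x y;
  graph_linear : forall a x x' y y',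
    g x y -> g x' y' -> g (a *: x + x') (a *: y + y');
  graph_single : forall y, g 0 y -> y = 0 }.

Hypothesis hg : linear_graph.

Definition graph_fun (x : M) : M' := projT1 (cid (graph_total hg x)).

Lemma graph_funP x : g x (graph_fun x).
Proof. by rewrite /graph_fun; case: (cid _). Qed.

Lemma graph_funE x y : g x y -> graph_fun x = y.
Proof.
move=> gxy; apply/eqP; rewrite -subr_eq0; apply/eqP/(graph_single hg).
have := graph_linear hg (-1) gxy (graph_funP x).
by rewrite !scaleN1r addNr addrC.
Qed.

Fact graph_fun_linear : linear graph_fun.
Proof.
by move=> a x y; apply/graph_funE/(graph_linear hg); apply: graph_funP.
Qed.
HB.instance Definition _ :=
  GRing.isLinear.Build R M M' *:%R graph_fun graph_fun_linear.

End GraphMap.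

Definition graph_map (R : pzRingType) (M M' : lmodType R) (g : M -> M' -> Prop)
  (hg : linear_graph g) : {linear M -> M'} := graph_fun hg.

Definition is_basis (R : pzRingType) (M : lmodType R) n (b : 'I_n -> M) : Prop :=
  bijective (fun c : 'rV[R]_n => \sum_(i < n) c 0 i *: b i).

Definition free_of_finite_rank (R : pzRingType) (M : lmodType R) : Prop :=
  exists n (b : 'I_n -> M), is_basis b.

Definition has_dim (K : fieldType) (W : lmodType K) (n : nat) : Prop :=
  exists b : 'I_n -> W, is_basis b.

Definition finite_dim (K : fieldType) (W : lmodType K) : Prop :=
  exists n, has_dim W n.

(* 0 when W is infinite-dimensional *)
Definition dimension (K : fieldType) (W : lmodType K) : nat :=
  xget 0%N [set n | has_dim W n].

(* idealr_closed excludes the unit ideal, so the ideals below are proper. *)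
Section DVR.
Variable R : idomainType.

Definition principal (c : R) : {pred R} := [pred x | `[< exists y, x = y * c >]].

Definition is_PID : Prop :=
  forall I : {pred R}, idealr_closed I -> exists c, I =i principal c.

Definition nonzero_prime_ideal (P : {pred R}) : Prop :=
  [/\ idealr_closed P, prime_idealr_closed P & exists2 x, x \in P & x != 0].

Definition maximal_ideal (I : {pred R}) : Prop :=
  idealr_closed I /\
  forall J : {pred R}, idealr_closed J -> {subset I <= J} -> {subset J <= I}.

Definition is_DVR : Prop :=
  is_PID /\
  exists P, nonzero_prime_ideal P /\ forall Q, nonzero_prime_ideal Q -> Q =i P.

Definition uniformizer (pi : R) : Prop := maximal_ideal (principal pi).

Lemma uniformizer_neq0 pi : is_DVR -> uniformizer pi -> pi != 0.
Proof.
move=> [_ [P [[idP _ [x Px x0]] _]]] [_ maxpi]; apply/eqP => pi0.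
case: (idP) => P0 _ _.
have sP : {subset principal pi <= P}.
  by move=> y /asboolP[z ->]; rewrite pi0 mulr0.
have /asboolP[z xE] := maxpi P idP sP x Px.
by move: x0; rewrite xE pi0 mulr0 eqxx.
Qed.

End DVR.

Section ResidueField.
Variables (R : idomainType) (pi : R) (hpi : uniformizer pi).

Definition uniformizer_ideal of uniformizer pi : R -> bool := principal pi.
HB.instance Definition _ :=
  isIdealr.Build R (uniformizer_ideal hpi) (proj1 hpi).
Definition residue_ideal : idealr R := uniformizer_ideal hpi.

Definition residue : Type := {ideal_quot residue_ideal}.
HB.instance Definition _ := EqQuotient.on residue.
HB.instance Definition _ := GRing.ComNzRing.on residue.

Definition residue_pi (x : R) : residue :=
  \pi_{ideal_quot residue_ideal} x.

Lemma residue_piE x y : residue_pi x = residue_pi y <-> exists z, x - y = z * pi.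
Proof.
split=> [/eqP|h].
  by rewrite /residue_pi -Quotient.idealrBE => /asboolP.
by apply/eqP; rewrite /residue_pi -Quotient.idealrBE; apply/asboolP.
Qed.

Lemma residue_reprK (q : residue) : residue_pi (repr q) = q.
Proof. by rewrite /residue_pi reprK. Qed.

Lemma residue_piM x y : residue_pi (x * y) = residue_pi x * residue_pi y.
Proof. exact: rmorphM (\pi_{ideal_quot residue_ideal}) _ _. Qed.
Lemma residue_piD x y : residue_pi (x + y) = residue_pi x + residue_pi y.
Proof. exact: raddfD (\pi_{ideal_quot residue_ideal}) _ _. Qed.
Lemma residue_pi1 : residue_pi 1 = 1.
Proof. exact: rmorph1 (\pi_{ideal_quot residue_ideal}). Qed.
Lemma residue_pi0 : residue_pi 0 = 0.
Proof. exact: raddf0 (\pi_{ideal_quot residue_ideal}). Qed.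

Lemma residue_inv_ex (q : residue) : exists p, q != 0 -> p * q = 1.
Proof.
case: (eqVneq q 0) => [->|q0]; first by exists 0.
case: (hpi) => -[I0 I1 IP] maxI.
pose J : {pred R} := [pred x | `[< exists a b, x = a * repr q + b * pi >]].
have [J1|J1] := boolP (1 \in J).
  case/asboolP: J1 => a [b ab]; exists (residue_pi a) => _.
  rewrite -{1}(residue_reprK q) -residue_piM -residue_pi1.
  by apply/residue_piE; exists (- b); rewrite ab mulNr opprD addrA subrr add0r.
have idJ : idealr_closed J.
  split=> //; first by apply/asboolP; exists 0, 0; rewrite !mul0r addr0.
  move=> c x y /asboolP[a [b ->]] /asboolP[a' [b' ->]]; apply/asboolP.
  by exists (c * a + a'), (c * b + b'); rewrite mulrDr !mulrDl !mulrA addrACA.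
have sIJ : {subset principal pi <= J}.
  by move=> x /asboolP[z ->]; apply/asboolP; exists 0, z; rewrite mul0r add0r.
have Jq : repr q \in J by apply/asboolP; exists 1, 0; rewrite mul1r mul0r addr0.
have /asboolP[z zE] := maxI J idJ sIJ _ Jq.
case/eqP: q0; rewrite -(residue_reprK q) -residue_pi0.
by apply/residue_piE; exists z; rewrite subr0.
Qed.

Definition residue_inv (q : residue) : residue :=
  if q == 0 then 0 else projT1 (cid (residue_inv_ex q)).

Fact residue_mulVf (q : residue) : q != 0 -> residue_inv q * q = 1.
Proof.
move=> q0; rewrite /residue_inv ifN //.
by case: (cid _) => p /= /(_ q0).
Qed.
Fact residue_inv0 : residue_inv 0 = 0.
Proof. by rewrite /residue_inv ifT. Qed.
HB.instance Definition _ :=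
  GRing.ComNzRing_isField.Build residue residue_mulVf residue_inv0.

Definition residue_field : fieldType := residue.

(* An R-module killed by pi is a vector space over R/pi, [a] acting as a. *)
Section KilledModule.
Variables (M : lmodType R) (hM : forall x : M, pi *: x = 0).

Definition residue_module of (forall x : M, pi *: x = 0) : Type := M.
Local Notation W := (residue_module hM).
HB.instance Definition _ := GRing.Zmodule.on W.

Definition residue_scale (a : residue_field) (x : W) : W :=
  repr (a : residue) *: (x : M).

Lemma residue_scaleE a (x : W) : residue_scale (residue_pi a) x = a *: (x : M).
Proof.
apply/eqP; rewrite /residue_scale -subr_eq0 -scalerBl; apply/eqP.
have [|z ->] := proj1 (residue_piE (repr (residue_pi a)) a).
  exact: residue_reprK.
by rewrite -scalerA hM scaler0.
Qed.

Fact residue_scaleA a b x :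
  residue_scale a (residue_scale b x) = residue_scale (a * b) x.
Proof.
rewrite -(residue_reprK a) -(residue_reprK b) -residue_piM !residue_scaleE.
exact: scalerA.
Qed.
Fact residue_scale1 : left_id 1 residue_scale.
Proof. by move=> x; rewrite -residue_pi1 residue_scaleE scale1r. Qed.
Fact residue_scaleDr : right_distributive residue_scale +%R.
Proof. by move=> a x y; exact: scalerDr. Qed.
Fact residue_scaleDl x : {morph residue_scale^~ x : a b / a + b}.
Proof.
move=> a b; rewrite -(residue_reprK a) -(residue_reprK b) -residue_piD.
by rewrite !residue_scaleE; exact: scalerDl.
Qed.
HB.instance Definition _ := GRing.Zmodule_isLmodule.Build residue_field W
  residue_scaleA residue_scale1 residue_scaleDr residue_scaleDl.

Definition residue_space : lmodType residue_field := W.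

End KilledModule.
End ResidueField.

(* A finite graph; loops and parallel edges are allowed.  The two ends of an
   edge are labelled by booleans, with no preferred direction; an incidence is
   a pair (edge, end). *)
Record graph := Graph {
  vertex : finType;
  edge : finType;
  endpoint : edge -> bool -> vertex }.

(* The chosen end is the tail of the edge. *)
Definition orientation (G : graph) := edge G -> bool.

Record sheaf (R : pzRingType) (G : graph) := Sheaf {
  vstalk : vertex G -> lmodType R;
  estalk : edge G -> lmodType R;
  restriction : forall e b, {linear vstalk (endpoint e b) -> estalk e} }.

Section Cohomology.
Variables (R : pzRingType) (G : graph) (o : orientation G).

Definition C0 (F : sheaf R G) : lmodType R := prodm (vstalk F).
Definition C1 (F : sheaf R G) : lmodType R := prodm (estalk F).

Definition coboundary_fun (F : sheaf R G) (s : C0 F) : C1 F :=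
  mkprodm (fun e =>
    restriction F e (o e) ((s : prodm _) (endpoint e (o e))) -
    restriction F e (~~ o e) ((s : prodm _) (endpoint e (~~ o e)))).

Fact coboundary_linear F : linear (@coboundary_fun F).
Proof.
move=> a x y; apply: prodmP => e; rewrite !mkprodmE.
by rewrite !linearP addrACA scalerDr.
Qed.
HB.instance Definition _ F :=
  GRing.isLinear.Build R (C0 F) (C1 F) *:%R (@coboundary_fun F)
    (@coboundary_linear F).

Definition coboundary F : {linear C0 F -> C1 F} := @coboundary_fun F.

Definition H0 (F : sheaf R G) : lmodType R := subm (kerm (coboundary F)).
Definition H1 (F : sheaf R G) : lmodType R := quom (imm (coboundary F)).

Record sheaf_map (A B : sheaf R G) := SheafMap {
  vmap : forall v, {linear vstalk A v -> vstalk B v};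
  emap : forall e, {linear estalk A e -> estalk B e};
  map_restriction : forall e b x,
    emap e (restriction A e b x) = restriction B e b (vmap (endpoint e b) x) }.

Definition C0_map A B (f : sheaf_map A B) : {linear C0 A -> C0 B} :=
  prodm_map (vmap f).
Definition C1_map A B (f : sheaf_map A B) : {linear C1 A -> C1 B} :=
  prodm_map (emap f).

Lemma C1_map_coboundary A B (f : sheaf_map A B) s :
  C1_map f (coboundary A s) = coboundary B (C0_map f s).
Proof.
apply: prodmP => e; rewrite !mkprodmE linearB.
by rewrite !map_restriction.
Qed.

Fact C1_map_im A B (f : sheaf_map A B) u :
  u \in imm (coboundary A) -> C1_map f u \in imm (coboundary B).
Proof.
move=> /asboolP[s ->]; apply/asboolP.
by exists (C0_map f s); rewrite C1_map_coboundary.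
Qed.

Definition H1_map A B (f : sheaf_map A B) : {linear H1 A -> H1 B} :=
  induced_quom (@C1_map_im A B f).

Definition exact_at (M M' M'' : lmodType R)
    (f : {linear M -> M'}) (g : {linear M' -> M''}) : Prop :=
  forall y, g y = 0 <-> exists x, f x = y.

Record short_exact A B C (i : sheaf_map A B) (p : sheaf_map B C) : Prop :=
  ShortExact {
    vinj : forall v, injective (vmap i v);
    einj : forall e, injective (emap i e);
    vexact : forall v, exact_at (vmap i v) (vmap p v);
    eexact : forall e, exact_at (emap i e) (emap p e);
    vsurj : forall v z, exists y, vmap p v y = z;
    esurj : forall e z, exists y, emap p e y = z }.

Section Connecting.
Variables (A B C : sheaf R G) (i : sheaf_map A B) (p : sheaf_map B C).

(* snake lemma: lift s to t over B; its coboundary comes from u over A *)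
Definition connecting_graph (s : H0 C) (c : H1 A) : Prop :=
  exists (t : C0 B) (u : C1 A),
    [/\ C0_map p t = val s, C1_map i u = coboundary B t & c = quom_pi _ u].

Lemma connecting_graphP : short_exact i p -> linear_graph connecting_graph.
Proof.
move=> [iv ie xv xe pv _]; split.
- move=> s; pose lift v := projT1 (cid (pv v ((val s : prodm _) v))).
  pose t : C0 B := mkprodm lift.
  have pt : C0_map p t = val s.
    apply: prodmP => v; rewrite !mkprodmE /lift.
    by case: (cid _).
  have dt : C1_map p (coboundary B t) = 0.
    by rewrite C1_map_coboundary pt; apply/eqP; exact: (valP s).
  have ex e : exists x, emap i e x = (coboundary B t : prodm _) e.
    apply/xe; have /(congr1 (fun w : prodm _ => w e)) := dt.
    by rewrite /= mkprodmE prodm0E.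
  pose u : C1 A := mkprodm (fun e => projT1 (cid (ex e))).
  exists (quom_pi _ u), t, u; split=> //.
  apply: prodmP => e; rewrite !(mkprodmE (M := estalk B)) mkprodmE.
  by case: (cid _) => x /= ->; rewrite mkprodmE.
- move=> a s s' c c' [t [u [ts us ->]]] [t' [u' [ts' us' ->]]].
  exists (a *: t + t'), (a *: u + u'); split.
  + by rewrite linearP ts ts'.
  + by rewrite !linearP us us'.
  + by rewrite linearP.
- move=> c [t [u [/= t0 us ->]]].
  have ex v : exists x, vmap i v x = (t : prodm _) v.
    apply/xv; have /(congr1 (fun w : prodm _ => w v)) := t0.
    by rewrite /= mkprodmE prodm0E.
  pose w : C0 A := mkprodm (fun v => projT1 (cid (ex v))).
  have wt : C0_map i w = t.
    apply: prodmP => v; rewrite !mkprodmE.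
    by case: (cid _) => x /= ->.
  rewrite -(linear0 (quom_pi (imm (coboundary A)))); apply/quom_piE.
  rewrite subr0; apply/asboolP; exists w; apply: prodmP => e; apply: (ie e).
  have := congr1 (fun w : prodm _ => w e) us.
  by rewrite -wt -C1_map_coboundary /= !mkprodmE.
Qed.

Definition connecting (h : short_exact i p) : {linear H0 C -> H1 A} :=
  graph_map (connecting_graphP h).

End Connecting.
End Cohomology.

Section DigitSheaves.
Variables (R : idomainType) (pi : R).

Definition modpi (k : nat) (M : lmodType R) : lmodType R :=
  quom (multm M (pi ^+ k)).

(* pi^k M / pi^(k+1) M *)
Definition grpi (k : nat) (M : lmodType R) : lmodType R :=
  quom (preimm (\val : {linear subm (multm M (pi ^+ k)) -> M})
               (multm M (pi ^+ k.+1))).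

Lemma multm_map (M M' : lmodType R) (f : {linear M -> M'}) c x :
  x \in multm M c -> f x \in multm M' c.
Proof.
by move=> /asboolP[y ->]; apply/asboolP; exists (f y); rewrite linearZ.
Qed.

Lemma multm_le (M : lmodType R) k (x : M) :
  x \in multm M (pi ^+ k.+1) -> idfun x \in multm M (pi ^+ k).
Proof.
move=> /asboolP[y ->]; apply/asboolP; exists (pi *: y).
by rewrite scalerA -exprSr.
Qed.

Definition modpi_map k (M M' : lmodType R) (f : {linear M -> M'}) :
  {linear modpi k M -> modpi k M'} :=
  induced_quom (@multm_map M M' f (pi ^+ k)).

Lemma grpi_mapP k (M M' : lmodType R) (f : {linear M -> M'}) :
  let g := induced_subm (@multm_map M M' f (pi ^+ k)) in
  forall x, x \in preimm (\val : {linear subm (multm M (pi ^+ k)) -> M})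
                         (multm M (pi ^+ k.+1)) ->
  g x \in preimm (\val : {linear subm (multm M' (pi ^+ k)) -> M'})
                 (multm M' (pi ^+ k.+1)).
Proof. by move=> g x; exact: (@multm_map M M' f (pi ^+ k.+1) (val x)). Qed.

Definition grpi_map k (M M' : lmodType R) (f : {linear M -> M'}) :
  {linear grpi k M -> grpi k M'} :=
  induced_quom (@grpi_mapP k M M' f).

Lemma grpi_inclP k (M : lmodType R) x :
  x \in preimm (\val : {linear subm (multm M (pi ^+ k)) -> M})
               (multm M (pi ^+ k.+1)) ->
  \val x \in multm M (pi ^+ k.+1).
Proof. by []. Qed.

Definition grpi_incl k (M : lmodType R) : {linear grpi k M -> modpi k.+1 M} :=
  induced_quom (@grpi_inclP k M).

Definition modpi_proj k (M : lmodType R) : {linear modpi k.+1 M -> modpi k M} :=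
  induced_quom (@multm_le M k).

(* [pi^k x] |-> [x] *)
Definition digit_graph k (M : lmodType R) (q : grpi k M) (r : modpi 1 M) : Prop :=
  exists (x : M) (y : subm (multm M (pi ^+ k))),
    [/\ val y = pi ^+ k *: x, q = quom_pi _ y & r = quom_pi _ x].

Definition torsion_free (M : lmodType R) : Prop :=
  forall (r : R) (x : M), r *: x = 0 -> r = 0 \/ x = 0.

Lemma free_torsion_free M : free_of_finite_rank M -> torsion_free M.
Proof.
move=> [n [b [f fK Kf]]] r x rx.
have [->|r0] := eqVneq r 0; [by left | right].
have h : r *: f x = 0.
  apply: (can_inj fK) => /=.
  transitivity (r *: x).
    by rewrite -[in RHS](Kf x) scaler_sumr; apply: eq_bigr => i _; rewrite mxE scalerA.
  by rewrite rx big1 // => i _; rewrite mxE scale0r.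
have fx0 : f x = 0.
  apply/rowP => j; move/rowP/(_ j): h; rewrite !mxE => /eqP.
  by rewrite mulf_eq0 (negPf r0) => /eqP.
rewrite -(Kf x) fx0 big1 // => i _; by rewrite mxE scale0r.
Qed.

Lemma digit_graphP k M :
  pi != 0 -> torsion_free M -> linear_graph (@digit_graph k M).
Proof.
move=> pi0 tf; split.
- move=> q; have /asboolP[x xE] := valP (repr q).
  by exists (quom_pi _ x), x, (repr q); rewrite quom_reprK.
- move=> a q q' r r' [x [y [yE -> ->]]] [x' [y' [y'E -> ->]]].
  exists (a *: x + x'), (a *: y + y'); split; rewrite ?linearP //.
  transitivity (a *: val y + val y'); first by [].
  by rewrite yE y'E.
- move=> r [x [y [yE /esym y0 ->]]].
  have : quom_pi (preimm (\val : {linear subm (multm M (pi ^+ k)) -> M})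
               (multm M (pi ^+ k.+1))) y = quom_pi _ 0 by rewrite y0 linear0.
  move/quom_piE; rewrite subr0 => /asboolP[z zE].
  rewrite -(linear0 (quom_pi (multm M (pi ^+ 1)))); apply/quom_piE.
  rewrite subr0; apply/asboolP; exists z; apply/eqP; rewrite -subr_eq0; apply/eqP.
  case: (tf (pi ^+ k) (x - pi ^+ 1 *: z)) => //.
    by rewrite scalerBr -yE scalerA -exprD addn1 -zE subrr.
  by move/eqP; rewrite expf_eq0 (negPf pi0) andbF.
Qed.

Definition digit_iso k M (pi0 : pi != 0) (tf : torsion_free M) :
  {linear grpi k M -> modpi 1 M} := graph_map (digit_graphP k pi0 tf).

Variable G : graph.

Definition mod_sheaf k (F : sheaf R G) : sheaf R G :=
  @Sheaf R G (fun v => modpi k (vstalk F v)) (fun e => modpi k (estalk F e))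
    (fun e b => modpi_map k (restriction F e b)).

Definition gr_sheaf k (F : sheaf R G) : sheaf R G :=
  @Sheaf R G (fun v => grpi k (vstalk F v)) (fun e => grpi k (estalk F e))
    (fun e b => grpi_map k (restriction F e b)).

Lemma grpi_incl_natural k (M M' : lmodType R) (f : {linear M -> M'}) q :
  grpi_incl k M' (grpi_map k f q) = modpi_map k.+1 f (grpi_incl k M q).
Proof.
rewrite -(quom_reprK q) [grpi_map _ _ _]quom_mapE.
rewrite [LHS]quom_mapE [grpi_incl _ _ _]quom_mapE.
by rewrite [RHS]quom_mapE.
Qed.

Lemma modpi_proj_natural k (M M' : lmodType R) (f : {linear M -> M'}) q :
  modpi_proj k M' (modpi_map k.+1 f q) = modpi_map k f (modpi_proj k M q).
Proof.
rewrite -(quom_reprK q) [modpi_map _ _ _ in LHS]quom_mapE.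
rewrite [LHS]quom_mapE [modpi_proj _ _ _]quom_mapE.
by rewrite [RHS]quom_mapE.
Qed.

Lemma digit_iso_natural k (M M' : lmodType R) (f : {linear M -> M'}) (pi0 : pi != 0)
    (tf : torsion_free M) (tf' : torsion_free M') q :
  digit_iso k pi0 tf' (grpi_map k f q) = modpi_map 1 f (digit_iso k pi0 tf q).
Proof.
apply: graph_funE.
have [x [y [yE qE rE]]] := graph_funP (digit_graphP k pi0 tf) q.
exists (f x), (induced_subm (@multm_map M M' f (pi ^+ k)) y); split.
- by rewrite /= yE linearZ.
- by rewrite qE; exact: quom_mapE.
- by rewrite [digit_iso _ _ _ _]rE; exact: quom_mapE.
Qed.

Definition sheaf_incl k F : sheaf_map (gr_sheaf k F) (mod_sheaf k.+1 F) :=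
  @SheafMap R G (gr_sheaf k F) (mod_sheaf k.+1 F)
    (fun v => grpi_incl k _) (fun e => grpi_incl k _)
    (fun e b => @grpi_incl_natural k _ _ (restriction F e b)).

Definition sheaf_proj k F : sheaf_map (mod_sheaf k.+1 F) (mod_sheaf k F) :=
  @SheafMap R G (mod_sheaf k.+1 F) (mod_sheaf k F)
    (fun v => modpi_proj k _) (fun e => modpi_proj k _)
    (fun e b => @modpi_proj_natural k _ _ (restriction F e b)).

Lemma grpi_inclE k (M : lmodType R) x :
  grpi_incl k M (quom_pi _ x) = quom_pi _ (val x).
Proof. exact: quom_mapE. Qed.

Lemma modpi_projE k (M : lmodType R) x :
  modpi_proj k M (quom_pi _ x) = quom_pi _ x.
Proof. exact: quom_mapE. Qed.

Lemma grpi_incl_inj k M : injective (grpi_incl k M).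
Proof.
move=> p q; rewrite -(quom_reprK p) -(quom_reprK q) !grpi_inclE.
by move/quom_piE => h; apply/quom_piE.
Qed.

Lemma modpi_exact k M : exact_at (grpi_incl k M) (modpi_proj k M).
Proof.
move=> q; split=> [|[p <-]]; last first.
  rewrite -(quom_reprK p) grpi_inclE modpi_projE.
  rewrite -[RHS](linear0 (quom_pi (multm M (pi ^+ k)))); apply/quom_piE.
  by rewrite subr0; exact: (valP (repr p)).
rewrite -(quom_reprK q) modpi_projE -(linear0 (quom_pi (multm M (pi ^+ k)))).
move/quom_piE; rewrite subr0 => h.
pose y : subm (multm M (pi ^+ k)) := Sub (repr q) h.
by exists (quom_pi _ y); rewrite grpi_inclE.
Qed.

Lemma modpi_proj_surj k M z : exists y, modpi_proj k M y = z.
Proof.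
by exists (quom_pi _ (repr z)); rewrite modpi_projE quom_reprK.
Qed.

Lemma digit_short_exact k F : short_exact (sheaf_incl k F) (sheaf_proj k F).
Proof.
split=> *; first [exact: grpi_incl_inj | exact: modpi_exact
  | exact: modpi_proj_surj].
Qed.

Record free_stalks (F : sheaf R G) : Prop := FreeStalks {
  free_vstalk : forall v, free_of_finite_rank (vstalk F v);
  free_estalk : forall e, free_of_finite_rank (estalk F e) }.

Definition sheaf_digit_iso k F (pi0 : pi != 0) (hF : free_stalks F) :
  sheaf_map (gr_sheaf k F) (mod_sheaf 1 F) :=
  @SheafMap R G (gr_sheaf k F) (mod_sheaf 1 F)
    (fun v => digit_iso k pi0 (free_torsion_free (free_vstalk hF v)))
    (fun e => digit_iso k pi0 (free_torsion_free (free_estalk hF e)))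
    (fun e b => @digit_iso_natural k _ _ (restriction F e b) pi0 _ _).

End DigitSheaves.

Section DigitMap.
Variables (R : idomainType) (pi : R) (hR : is_DVR R) (hpi : uniformizer pi).
Variables (G : graph) (o : orientation G) (F : sheaf R G) (hF : free_stalks F).

(* pi ^+ 1 is convertible to pi, so mod_sheaf pi 1 F is F / pi F. *)
Definition digit_map (k : nat) :
    {linear H0 o (mod_sheaf pi k F) -> H1 o (mod_sheaf pi 1 F)} :=
  H1_map o (sheaf_digit_iso k (uniformizer_neq0 hR hpi) hF)
  \o connecting o (digit_short_exact pi k F).

Lemma modpi1_killed (M : lmodType R) (q : modpi pi 1 M) : pi *: q = 0.
Proof.
rewrite -(quom_reprK q) -linearZ -(linear0 (quom_pi (multm M (pi ^+ 1)))).
by apply/quom_piE; rewrite subr0; apply/asboolP; exists (repr q).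
Qed.

Lemma H1_mod1_killed (c : H1 o (mod_sheaf pi 1 F)) : pi *: c = 0.
Proof.
rewrite -(quom_reprK c) -linearZ -[RHS](linear0 (quom_pi _)).
congr (quom_pi _ _); apply: prodmP => e.
by rewrite [LHS]mkprodmE [RHS]mkprodmE; exact: modpi1_killed.
Qed.

Lemma im_digit_killed k (c : subm (imm (digit_map k))) : pi *: c = 0.
Proof. by apply: val_inj; exact: H1_mod1_killed. Qed.

(* im (digit_map k), as a vector space over the residue field *)
Definition im_digit (k : nat) : lmodType (residue_field hpi) :=
  residue_space hpi (@im_digit_killed k).

End DigitMap.

Definition smith_mx (R : nzRingType) (pi : R) (a : seq nat) m n : 'M[R]_(m, n) :=
  \matrix_(i < m, j < n)
    if (i == j :> nat) && (i < size a)%N then pi ^+ nth 0%N a i else 0.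

Definition matrix_rank (R : idomainType) m n (A : 'M[R]_(m, n)) : nat :=
  \rank (map_mx (@tofrac R) A).

(* M is isomorphic to R^n + R/pi^(e_1) + ... + R/pi^(e_N) with all e_i >= 1 *)
Definition has_torsion_summands (R : idomainType) (pi : R) (M : lmodType R)
    (N : nat) : Prop :=
  exists (n : nat) (e : 'I_N -> nat),
    (forall i, (0 < e i)%N) /\
    exists f : {linear ('rV[R]_n * prodm (fun i => modpi pi (e i) R^o))%type -> M},
      bijective f.

(* Main.v *)
From HB Require Import structures.
Require Import Defs.
From mathcomp Require Import all_boot all_order all_algebra.
From mathcomp Require Import perm generic_quotient ring_quotient ring zify.
From mathcomp Require Import boolp classical_sets functions cardinality.

Set Implicit Arguments.
Unset Strict Implicit.
Unset Printing Implicit Defensive.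
Import GRing.Theory.
Local Open Scope ring_scope.

(* A Smith form of [d] presents H^1(G; F) as the direct sum of the modules
   R/(delta_i), where delta_i is pi^(a_i) for i < r and 0 otherwise.  Lifting
   cochains through F -> F/pi^k and F -> F/pi^(k+1) shows that the image of the
   k-th digit map is the image of the pi^k-torsion of H^1(G; F) in
   H^1(G; F)/pi, which is H^1(G; F/pi) because H^1 is right exact.  On a
   summand R/pi^(a_i), the pi^k-torsion is generated by pi^max(a_i - k, 0); it
   is nonzero modulo pi exactly when 1 <= a_i <= k, and then it contributes one
   dimension.  A free summand has no torsion. *)

(** * Discrete valuation rings *)

Section DVRArithmetic.
Variable R : idomainType.

Lemma principalP (c x : R) : reflect (exists y, x = y * c) (x \in principal c).
Proof. exact: asboolP. Qed.

Lemma principal_closed (c : R) : c \isn't a GRing.unit -> idealr_closed (principal c).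
Proof.
move=> cN; split=> [||a x y].
- by apply/principalP; exists 0; rewrite mul0r.
- apply/principalP => -[y yc]; move/negP: cN; apply.
  by apply/unitrPr; exists y; rewrite mulrC -yc.
- move=> /principalP[u ->] /principalP[v ->]; apply/principalP.
  by exists (a * u + v); rewrite mulrDl mulrA.
Qed.

(** Zorn's lemma on the ideals containing [x]: these are proper by [idealr_closed], so the union of
    a nonempty chain of them still misses 1. *)
Lemma exists_maximal_ideal (x : R) : x \isn't a GRing.unit ->
  exists I, maximal_ideal I /\ x \in I.
Proof.
move=> xN.
(* The union of the empty chain is empty, hence the first alternative. *)
pose P (A : set R) :=
  A = set0 \/ (idealr_closed (fun y => `[< A y >]) /\ A x).
have [S SP SU|A [PA maxA]] := @Zorn_bigcup R P.
  have [[B SB B0]|S0] := pselect (exists2 B, S B & (B !=set0)%classic); last first.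
    left; rewrite -subset0 => y [B SB By].
    by case: S0; exists B => //; exists y.
  have idB D y : S D -> D y -> idealr_closed (fun y => `[< D y >]) /\ D x.
    by move=> SD Dy; case: (SP D SD) => // D0; rewrite D0 in Dy.
  case: B0 => z Bz; right; split; last first.
    by exists B => //; have [] := idB B z SB Bz.
  split=> [||a u v].
  - apply/asboolP; exists B => //; have [[+ _ _] _] := idB B z SB Bz.
    by move=> /asboolP.
  - apply/negP => /asboolP[D SD D1]; have [[_ + _] _] := idB D 1 SD D1.
    by move=> /negP; apply; apply/asboolP.
  move=> /asboolP[D SD Du] /asboolP[E SE Ev]; apply/asboolP.
  have [DE|ED] := SU D E SD SE.
    exists E => //; have [[_ _ h] _] := idB E v SE Ev.
    apply/asboolP; apply: h; apply/asboolP => //; exact: DE.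
  exists D => //; have [[_ _ h] _] := idB D u SD Du.
  apply/asboolP; apply: h; apply/asboolP => //; exact: ED.
have px : idealr_closed (principal x) := principal_closed xN.
have xx : x \in principal x by apply/principalP; exists 1; rewrite mul1r.
have asP (I : {pred R}) : (fun y => `[< y \in I >]) = I.
  by apply/funext => y; rewrite asboolb.
case: PA => [A0|[idA Ax]].
  (* The maximal set is not empty, since the ideal generated by [x] is larger. *)
  exfalso; apply: (maxA [set y | y \in principal x]%classic).
    rewrite A0; split=> [//|/(_ x)]; exact.
  right; split=> //=.
  by rewrite asP.
exists (fun y => `[< A y >]); split; last exact/asboolP.
split=> // J idJ sAJ y Jy; apply/asboolP; apply: contrapT => nAy.
apply: (maxA [set y | y \in J]%classic).
  split; first by move=> z /asboolP /sAJ.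
  by move/(_ y Jy).
right; split; last by apply: sAJ; apply/asboolP.
by rewrite asP.
Qed.

(** If [u] lies outside [I], maximality forces 1 = a u + b with b in [I], and then v = a (u v) + v
    b. *)
Lemma maximal_ideal_prime (I : {pred R}) : maximal_ideal I -> prime_idealr_closed I.
Proof.
move=> [idI maxI] u v uvI; have [//|uI /=] := boolP (u \in I).
have [I0 I1 IP] := idI.
pose J : {pred R} := [pred x | `[< exists a b, b \in I /\ x = a * u + b >]].
have [J1|J1] := boolP (1 \in J).
  case/asboolP: J1 => a [b [bI ab]].
  have vb : v * b \in I by rewrite -[_ * _]addr0; exact: IP.
  suff -> : v = a * (u * v) + v * b by exact: IP.
  by rewrite mulrA mulrC -mulrDr -{1}[v]mulr1 ab mulrC [_ * v]mulrC.
case/negP: uI; apply: (maxI J).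
- split=> //.
    by apply/asboolP; exists 0, 0; rewrite mul0r addr0.
  move=> c x y /asboolP[a [b [bI ->]]] /asboolP[a' [b' [bI' ->]]]; apply/asboolP.
  exists (c * a + a'), (c * b + b'); split; first exact: IP.
  by rewrite mulrDr mulrDl !mulrA addrACA.
- by move=> x xI; apply/asboolP; exists 0, x; rewrite mul0r add0r.
- by apply/asboolP; exists 1, 0; rewrite mul1r addr0.
Qed.

Variable pi : R.
Hypotheses (hR : is_DVR R) (hpi : uniformizer pi).

Lemma uniformizer_nonunit : pi \isn't a GRing.unit.
Proof.
apply/negP => /unitrPr[y yE]; case: hpi => -[_ /negP + _] _; apply.
by apply/principalP; exists y; rewrite mulrC.
Qed.

(** A nonzero nonunit lies in a maximal ideal, which is then a nonzero prime; so is (pi), and the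
    two agree because a DVR has only one nonzero prime. *)
Lemma nonunit_principal x : x \isn't a GRing.unit -> exists y, x = y * pi.
Proof.
move=> xN; apply/principalP; have [->|x0] := eqVneq x 0.
  by case: hpi => -[].
have [I [maxI xI]] := exists_maximal_ideal xN.
have [_ [P [_ uP]]] := hR.
have pi0 := uniformizer_neq0 hR hpi.
rewrite (uP (principal pi)) -?(uP I) //.
- by split; [case: maxI|exact: maximal_ideal_prime|exists x].
- split; [by case: hpi|exact: maximal_ideal_prime|exists pi => //].
  by apply/principalP; exists 1; rewrite mul1r.
Qed.

(** Split off factors [pi] until the cofactor is a unit. If this never ended, the nonzero [x] would
    lie in every ideal (pi^k), and [pi] would be a unit. *)
Lemma DVR_factor x : x != 0 ->
  exists k u, u \is a GRing.unit /\ x = u * pi ^+ k.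
Proof.
move=> x0; have pi0 := uniformizer_neq0 hR hpi.
have [[k [u [xE uN]]]|nN] := pselect (exists k u, x = u * pi ^+ k /\ u \is a GRing.unit).
  by exists k, u.
have dvdx k : exists y, x = y * pi ^+ k.
  elim: k => [|k [y yE]]; first by exists x; rewrite mulr1.
  have [yU|yN] := boolP (y \is a GRing.unit); first by case: nN; exists k, y.
  have [z zE] := nonunit_principal yN.
  by exists z; rewrite yE zE exprS mulrA.
pose I : {pred R} := [pred z | `[< forall k, exists y, z = y * pi ^+ k >]].
have idI : idealr_closed I.
  split=> [||a u v].
  - by apply/asboolP => k; exists 0; rewrite mul0r.
  - apply/asboolP => /(_ 1%N)[y yE]; move/negP: uniformizer_nonunit; apply.
    by apply/unitrPr; exists y; rewrite mulrC -[pi]expr1.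
  - move=> /asboolP uI /asboolP vI; apply/asboolP => k.
    have [y ->] := uI k; have [z ->] := vI k.
    by exists (a * y + z); rewrite mulrDl mulrA.
(* I = pi I, so a generator c of I satisfies c = e pi c, which is impossible
   unless c = 0. *)
have [c cE] := hR.1 I idI.
have cI : c \in I by rewrite cE; apply/principalP; exists 1; rewrite mul1r.
have /asboolP cI' := cI.
have [d dE] := cI' 1%N.
have dI : d \in I.
  apply/asboolP => k; have [y yE] := cI' k.+1; exists y.
  by apply: (mulIf pi0); rewrite -[in LHS](expr1 pi) -dE yE exprSr mulrA.
move: dI; rewrite cE => /principalP[e eE].
have xI : x \in I by apply/asboolP.
move: xI; rewrite cE => /principalP[f fE].
have c0 : c != 0 by apply: contraNneq x0 => c0; rewrite fE c0 mulr0.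
case/negP: uniformizer_nonunit; apply/unitrPr; exists e.
apply: (mulIf c0); rewrite mul1r {2}dE eE expr1; ring.
Qed.

End DVRArithmetic.

(** * Smith normal form *)

Section SmithForm.
Variables (R : idomainType) (pi : R).
Hypotheses (hR : is_DVR R) (hpi : uniformizer pi).

Definition mx_equiv m n (A B : 'M[R]_(m, n)) : Prop :=
  exists (U : 'M[R]_m) (V : 'M[R]_n),
    [/\ U \in unitmx, V \in unitmx & U *m A *m V = B].

Lemma mx_equiv_trans m n (A B C : 'M[R]_(m, n)) :
  mx_equiv A B -> mx_equiv B C -> mx_equiv A C.
Proof.
move=> [U [V [uU uV <-]]] [U' [V' [uU' uV' <-]]].
exists (U' *m U), (V *m V'); rewrite !unitmx_mul uU uU' uV uV'.
by split=> //; rewrite !mulmxA.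
Qed.

Lemma mx_equivZ m n (A B : 'M[R]_(m, n)) c :
  mx_equiv A B -> mx_equiv (c *: A) (c *: B).
Proof.
move=> [U [V [uU uV <-]]]; exists U, V; split=> //.
by rewrite -scalemxAr -scalemxAl.
Qed.

Lemma mx_equiv_block m n (A B : 'M[R]_(m, n)) :
  mx_equiv A B ->
  mx_equiv (block_mx 1%:M 0 0 A : 'M_(1 + m, 1 + n)) (block_mx 1%:M 0 0 B).
Proof.
move=> [U [V [uU uV <-]]]; exists (block_mx 1%:M 0 0 U), (block_mx 1%:M 0 0 V).
split; rewrite ?unitmxE ?det_ublock ?det1 ?mul1r -?unitmxE //.
by rewrite !mulmx_block !(mul1mx, mulmx1, mul0mx, mulmx0, addr0, add0r).
Qed.

(** After the unit is moved to the corner, one elimination on each side clears its row and column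
    and leaves the Schur complement. *)
Lemma mx_equiv_pivot m n (A : 'M[R]_(1 + m, 1 + n)) i j :
  A i j \is a GRing.unit ->
  exists B : 'M[R]_(m, n), mx_equiv A (block_mx 1%:M 0 0 B).
Proof.
move=> uA; pose A1 := xrow i 0 (xcol j 0 A).
have A1E : mx_equiv A A1.
  exists (tperm_mx i 0), (tperm_mx j 0); split; rewrite ?unitmx_perm //.
  by rewrite -xrowE -xcolE /A1; apply/matrixP => x y; rewrite !mxE.
have uA1 : A1 0 0 \is a GRing.unit by rewrite !mxE !tpermR.
(* Forget the value of [A1], which [mxE] would unfold. *)
move: A1 A1E uA1 => A1 A1E uA1.
pose a := A1 0 0; pose r : 'rV_n := ursubmx A1; pose c : 'cV_m := dlsubmx A1.
have A1b : A1 = block_mx a%:M r c (drsubmx A1).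
  rewrite -[LHS]submxK; congr block_mx; apply/matrixP => x y.
  by rewrite !mxE !ord1 eqxx mulr1n; congr (A1 _ _); apply/val_inj.
exists (drsubmx A1 - a^-1 *: (c *m r)); apply: mx_equiv_trans A1E _.
exists (block_mx (a^-1)%:M 0 (- a^-1 *: c) 1%:M), (block_mx 1%:M (- a^-1 *: r) 0 1%:M).
split.
- by rewrite unitmxE det_lblock det1 det_scalar1 mulr1 unitrV.
- by rewrite unitmxE det_ublock !det1 mulr1 unitr1.
rewrite {1}A1b !mulmx_block !(mul1mx, mulmx1, mul0mx, mulmx0, addr0, add0r).
congr block_mx.
- by rewrite -scalar_mxM mulVr.
- by rewrite -scalar_mxM mulVr // mul1mx mul_scalar_mx scaleNr addNr.
- by rewrite mul_mx_scalar scalerA mulrN mulrV // scaleN1r addNr.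
rewrite mul_mx_scalar scalerA mulrN mulrV // scaleN1r addNr mul0mx add0r.
by rewrite -scalemxAl scaleNr addrC.
Qed.

(** The recursive shape of the form: once the least power pi^v is factored out, the later exponents
    are counted from [v]. *)
Lemma smith_mx_cons m n v (a : seq nat) :
  smith_mx pi (v :: map (addn v) a) m.+1 n.+1 =
  pi ^+ v *: (block_mx 1%:M 0 0 (smith_mx pi a m n) : 'M_(1 + m, 1 + n)).
Proof.
apply/matrixP => i j; rewrite !mxE.
case: splitP => i' iE; rewrite mxE; case: splitP => j' jE; rewrite !mxE iE jE ?ord1.
- by rewrite eqxx /= mulr1.
- by rewrite /= mulr0.
- by rewrite /= mulr0.
rewrite /= size_map !add1n eqSS ltnS; case: ifP => [/andP[_ ia]|]; last by rewrite mulr0.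
by rewrite (nth_map 0%N) // exprD.
Qed.

(** Divisibility is total in a DVR, so an entry of least valuation divides all the others and serves
    as pivot; no gcd computation occurs. *)
Lemma smith_form m n (A : 'M[R]_(m, n)) :
  exists a : seq nat, [/\ sorted leq a, (size a <= minn m n)%N &
    mx_equiv A (smith_mx pi a m n)].
Proof.
elim: m n A => [|m IH] [|n] A; try (by exists [::]; split=> //;
  exists 1%:M, 1%:M; split; rewrite ?unitmx1 // mul1mx mulmx1;
  apply/matrixP => -[x xP] [y yP]; exfalso; move: xP yP; rewrite ?ltn0).
have [->|A0] := eqVneq A 0.
  exists [::]; split=> //; exists 1%:M, 1%:M; split; rewrite ?unitmx1 //.
  by rewrite mul1mx mulmx1; apply/matrixP => i j; rewrite !mxE andbF.
pose P v := `[< exists i j u, u \is a GRing.unit /\ A i j = u * pi ^+ v >].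
have exP : exists v, P v.
  have [i [j Aij]] : exists i j, A i j != 0.
    apply: contrapT => nA; case/eqP: A0; apply/matrixP => i j; rewrite mxE.
    by apply: contrapT => /eqP Aij; apply: nA; exists i, j.
  have [v [u uE]] := DVR_factor hR hpi Aij.
  by exists v; apply/asboolP; exists i, j, u.
have [v /asboolP[i [j [u [uU uE]]]] minv] := ex_minnP exP.
have dvdA x y : exists z, A x y = pi ^+ v * z.
  have [->|Axy] := eqVneq (A x y) 0; first by exists 0; rewrite mulr0.
  have [w [t [tU tE]]] := DVR_factor hR hpi Axy.
  have vw : (v <= w)%N by apply: minv; apply/asboolP; exists x, y, t.
  by exists (t * pi ^+ (w - v)); rewrite tE mulrCA -exprD subnKC.
(* Dividing by the least valuation of an entry creates a unit entry, and makes
   the exponents found later at least [v]. *)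
pose A' := \matrix_(x, y) projT1 (cid (dvdA x y)).
have AE : A = pi ^+ v *: A'.
  by apply/matrixP => x y; rewrite !mxE; case: (cid _).
have A'ij : A' i j \is a GRing.unit.
  suff -> : A' i j = u by [].
  have pv0 : pi ^+ v != 0 by rewrite expf_neq0 // (uniformizer_neq0 hR hpi).
  by apply: (mulfI pv0); rewrite [RHS]mulrC -uE [in RHS]AE [RHS]mxE.
have [B AB] := @mx_equiv_pivot m n A' i j A'ij.
have [a [sa za Ba]] := IH n B.
exists (v :: map (addn v) a); split.
- rewrite /= path_min_sorted.
    rewrite sorted_map; case: (a) sa => //= x s.
    by apply: sub_path => y z; rewrite /= leq_add2l.
  by apply/allP => _ /mapP[y _ ->]; exact: leq_addr.
- by rewrite /= size_map minnSS ltnS.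
- rewrite smith_mx_cons AE; apply/mx_equivZ/(mx_equiv_trans AB).
  exact: mx_equiv_block.
Qed.

(** Over the fraction field the powers of [pi] are invertible, so the matrix is an invertible
    diagonal one times [pid_mx]. *)
Lemma smith_mx_rank m n (a : seq nat) : (size a <= minn m n)%N ->
  matrix_rank (smith_mx pi a m n) = size a.
Proof.
rewrite leq_min => /andP[am an].
pose K := {fraction R}.
(* Beyond [size a] the default 0 of [nth] gives the entry pi^0 = 1, which keeps the diagonal
   invertible. *)
pose d : 'rV[K]_m := \row_(i < m) (tofrac pi ^+ nth 0%N a i).
have pi0 : tofrac pi != 0 by rewrite tofrac_eq0 (uniformizer_neq0 hR hpi).
have ud : diag_mx d \in unitmx.
  rewrite unitmxE det_diag unitfE; apply/prodf_neq0 => i _.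
  by rewrite mxE expf_neq0.
rewrite /matrix_rank.
have -> : map_mx (@tofrac R) (smith_mx pi a m n) = diag_mx d *m pid_mx (size a).
  apply/matrixP => i j; rewrite mul_diag_mx !mxE.
  by case: ifP => _; rewrite ?rmorphXn ?rmorph0 ?mulr1 ?mulr0.
by rewrite eqmxMfull ?row_full_unit // rank_pid_mx.
Qed.

Lemma matrix_rank_equiv m n (A B : 'M[R]_(m, n)) :
  mx_equiv A B -> matrix_rank A = matrix_rank B.
Proof.
move=> [U [V [uU uV <-]]]; rewrite /matrix_rank !map_mxM /=.
have unit_map k (W : 'M[R]_k) : W \in unitmx -> map_mx (@tofrac R) W \in unitmx.
  by rewrite !unitmxE det_map_mx; exact: rmorph_unit.
rewrite mxrankMfree ?row_free_unit ?unit_map //.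
by rewrite eqmxMfull // row_full_unit unit_map.
Qed.

End SmithForm.

(** * Linear algebra over the residue field *)

Lemma quom_pi_eq0 (R : pzRingType) (M : lmodType R) (N : submodule M) x :
  quom_pi N x = 0 <-> x \in N.
Proof. by rewrite -(linear0 (quom_pi N)) quom_piE subr0. Qed.

Lemma inj_surj_bijective (T U : Type) (f : T -> U) :
  injective f -> (forall y, exists x, f x = y) -> bijective f.
Proof.
move=> fI fS; exists (fun y => projT1 (cid (fS y))) => [x|y].
  by apply: fI; case: (cid _).
by case: (cid _).
Qed.

Section Combinations.
Variables (R : pzRingType) (M : lmodType R) (n : nat) (b : 'I_n -> M).

(** The map that [is_basis] requires to be bijective, named so that it can carry a linear
    structure. *)
Definition lin_comb (c : 'rV[R]_n) : M := \sum_(i < n) c 0 i *: b i.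

Fact lin_comb_linear : linear lin_comb.
Proof.
move=> a x y; rewrite /lin_comb scaler_sumr -big_split /=.
by apply: eq_bigr => i _; rewrite !mxE scalerDl scalerA.
Qed.
HB.instance Definition _ :=
  GRing.isLinear.Build R 'rV[R]_n M *:%R lin_comb lin_comb_linear.

End Combinations.

(** Coordinates are rows, while [A] holds the images of the basis in its columns; hence the
    transpose. *)
Lemma lin_combM (R : comNzRingType) (M N : lmodType R) (f : {linear M -> N}) m n
    (b : 'I_n -> M) (b' : 'I_m -> N) (A : 'M[R]_(m, n)) c :
  (forall j, f (b j) = \sum_(i < m) A i j *: b' i) ->
  f (lin_comb b c) = lin_comb b' (c *m A^T).
Proof.
move=> fb; rewrite /lin_comb linear_sum.
under eq_bigr do rewrite linearZ /= fb scaler_sumr.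
rewrite exchange_big /=; apply: eq_bigr => i _.
rewrite mxE scaler_suml; apply: eq_bigr => j _.
by rewrite mxE scalerA.
Qed.

(** The two change-of-basis matrices have product 1 of size [m] and factor through K^n, so the rank
    bound gives m <= n. *)
Lemma has_dim_le (K : fieldType) (W : lmodType K) m n :
  has_dim W m -> has_dim W n -> (m <= n)%N.
Proof.
move=> [b [g bK gK]] [b' [g' bK' gK']].
pose M := \matrix_(i < m) g' (b i); pose N := \matrix_(i < n) g (b' i).
have change p q (u : 'I_p -> W) (v : 'I_q -> W) h (P : 'M_(p, q)) c :
    cancel h (lin_comb v) -> P = \matrix_i h (u i) -> lin_comb v (c *m P) = lin_comb u c.
  move=> hK ->; rewrite /lin_comb -/(lin_comb v _).
  rewrite mulmx_sum_row linear_sum; apply: eq_bigr => i _.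
  by rewrite linearZ /= rowK; congr (_ *: _); exact: hK.
have MN : M *m N = 1%:M.
  apply/row_matrixP => i; rewrite !rowE mulmxA mulmx1.
  apply: (can_inj bK); rewrite -/(lin_comb b _) -/(lin_comb b _).
  by rewrite (change _ _ b' b g) // (change _ _ b b' g').
rewrite -(mxrank1 K m) -MN; apply: leq_trans (mxrankM_maxl _ _) _.
exact: rank_leq_col.
Qed.

Lemma dimension_eq (K : fieldType) (W : lmodType K) n : has_dim W n -> dimension W = n.
Proof.
move=> Wn; rewrite /dimension; case: xgetP => [p _ Wp|/(_ n)/(_ Wn)//].
by apply/eqP; rewrite eqn_leq !(@has_dim_le K W).
Qed.

(** A basis criterion phrased over [R]: the vectors span, and every relation has its coefficients in
    (pi). The dimension count below then needs no residue classes. *)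
Lemma killed_module_has_dim (R : idomainType) (pi : R) (hpi : uniformizer pi)
    (M : lmodType R) (hM : forall x : M, pi *: x = 0) n (b : 'I_n -> M) :
  (forall x, exists c, x = lin_comb b c) ->
  (forall c, lin_comb b c = 0 -> forall i, exists y, c 0 i = y * pi) ->
  has_dim (residue_space hpi hM) n.
Proof.
move=> bS bF; exists b.
have combE (q : 'rV[residue_field hpi]_n) :
    (\sum_(i < n) q 0 i *: (b i : residue_space hpi hM)) =
    lin_comb b (\row_i repr (q 0 i : residue hpi)).
  by apply: eq_bigr => i _; rewrite mxE.
apply: inj_surj_bijective => [q q'|x].
  move=> e; have /eqP := etrans (etrans (esym (combE q)) e) (combE q').
  rewrite -(@subr_eq0 M) -linearB => /eqP /bF qq'.
  apply/rowP => i; have [y] := qq' i; rewrite !mxE => yE.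
  rewrite -(residue_reprK (q 0 i)) -(residue_reprK (q' 0 i)).
  by apply/residue_piE; exists y.
have [c ->] := bS x; exists (\row_i residue_pi hpi (c 0 i)).
apply: eq_bigr => i _; rewrite mxE.
exact: residue_scaleE.
Qed.

(** A sum, like [lin_comb], so that linear maps pass through both in the same way. *)
Definition embed_row (R : pzRingType) m (J : {set 'I_m}) (c : 'rV[R]_#|J|) : 'rV[R]_m :=
  \sum_j c 0 j *: delta_mx 0 (enum_val j).

Lemma embed_rowE (R : nzRingType) m (J : {set 'I_m}) (c : 'rV[R]_#|J|) j :
  embed_row c 0 (enum_val j) = c 0 j.
Proof.
rewrite /embed_row summxE (bigD1 j) //= !mxE !eqxx mulr1 big1 ?addr0 // => i ij.
by rewrite !mxE (inj_eq enum_val_inj) eq_sym (negPf ij) mulr0.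
Qed.

Lemma embed_row0 (R : nzRingType) m (J : {set 'I_m}) (c : 'rV[R]_#|J|) i :
  i \notin J -> embed_row c 0 i = 0.
Proof.
move=> iJ; rewrite /embed_row summxE big1 // => j _; rewrite !mxE eqxx /=.
case: eqP => [ij|_]; last by rewrite mulr0.
by rewrite ij enum_valP in iJ.
Qed.

(** * Modules presented by a Smith matrix *)

Lemma card_count m (a : seq nat) (P : pred nat) : (size a <= m)%N ->
  #|[set i : 'I_m | (i < size a)%N && P (nth 0%N a i)]| = count P a.
Proof.
move=> am; rewrite -sum1_card -sum1_count (big_nth 0%N) big_mkord.
rewrite (big_ord_widen_cond m (fun i => P (nth 0%N a i)) (fun=> 1%N)) //.
by apply: eq_bigl => i; rewrite inE andbC.
Qed.

(* An entry [0], past the end of [a], stands for a free summand R/(0). *)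
Definition smith_divisor (R : nzRingType) (pi : R) (a : seq nat) (i : nat) : R :=
  if (i < size a)%N then pi ^+ nth 0%N a i else 0.

Lemma smith_mxE (R : nzRingType) (pi : R) a m n :
  smith_mx pi a m n = diag_mx (\row_i smith_divisor pi a i) *m pid_mx (size a).
Proof.
apply/matrixP => i j; rewrite mul_diag_mx !mxE /smith_divisor.
by case: eqP => _ /=; case: ifP; rewrite ?mulr1 ?mulr0.
Qed.

Lemma smith_image (R : comNzRingType) (pi : R) a m n (c : 'rV[R]_m) : (size a <= n)%N ->
  (exists x, c = x *m (smith_mx pi a m n)^T) <->
  (forall i, exists y, c 0 i = y * smith_divisor pi a i).
Proof.
move=> an; rewrite smith_mxE trmx_mul tr_diag_mx tr_pid_mx; split=> [[x ->] i|h].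
  exists ((x *m pid_mx (size a) : 'rV_m) 0 i).
  by rewrite mulmxA mul_mx_diag !mxE.
pose y := \row_i projT1 (cid (h i)).
(* Cutting [y] off after [size a] coordinates is harmless, as the later divisors are 0. *)
exists (y *m pid_mx (size a)); rewrite mulmxA -(mulmxA y) pid_mx_id //.
apply/rowP => i; rewrite mul_mx_diag !mxE (bigD1 i) //= big1 => [|j ji].
  rewrite !mxE eqxx /= addr0; case: (cid _) => z /= ->; rewrite /smith_divisor.
  by case: ifP; rewrite ?mulr0 ?mulr1.
by rewrite !mxE (_ : (j == i :> nat) = false) ?mulr0 //; exact: negbTE ji.
Qed.

Lemma prodm_linear (R : pzRingType) (I : finType) (M : I -> lmodType R) a
    (x y : prodm M) i : prodm_val (a *: x + y) i = a *: prodm_val x i + prodm_val y i.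
Proof. by rewrite [LHS]mkprodmE [X in X + _]mkprodmE. Qed.

Section Presentation.
Variables (R : idomainType) (pi : R) (hR : is_DVR R) (hpi : uniformizer pi).
Variables (H : lmodType R) (m : nat) (kappa : {linear 'rV[R]_m -> H}) (a : seq nat).
Hypothesis size_a : (size a <= m)%N.
Hypothesis kappa_surj : forall h, exists c, kappa c = h.
Hypothesis kappa_ker : forall c,
  kappa c = 0 <-> forall i, exists y, c 0 i = y * smith_divisor pi a i.

Let pi_neq0 : pi != 0 := uniformizer_neq0 hR hpi.

(** The standard generators with 1 <= a_i <= k give the basis: pi^k kills them, and [pi] divides
    their delta_i, so they stay independent modulo [pi]. *)
Lemma presentation_digit_dim (Q : lmodType R) (psi : {linear H -> Q})
    (psi_ker : forall h, psi h = 0 <-> exists h', h = pi *: h')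
    (N : submodule Q) k
    (N_im : forall q, q \in N <-> exists h, pi ^+ k *: h = 0 /\ q = psi h)
    (hN : forall x : subm N, pi *: x = 0) :
  has_dim (residue_space hpi hN) (count (fun x => 1 <= x <= k)%N a).
Proof.
pose P x := (1 <= x <= k)%N.
pose J := [set i : 'I_m | (i < size a)%N && P (nth 0%N a i)].
rewrite -(card_count P size_a) -/J.
have JN (j : 'I_#|J|) : psi (kappa (delta_mx 0 (enum_val j))) \in N.
  apply/N_im; exists (kappa (delta_mx 0 (enum_val j))); split=> //.
  rewrite -linearZ; apply/kappa_ker => i; rewrite !mxE eqxx /=.
  have [->|_] := eqVneq i (enum_val j); last by exists 0; rewrite mulr0 mul0r.
  have := enum_valP j; rewrite inE => /andP[ja /andP[_ jk]].
  exists (pi ^+ (k - nth 0%N a (enum_val j))).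
  by rewrite /smith_divisor ja mulr1 -exprD subnK.
pose b j : subm N := exist (fun x => x \in N) _ (JN j).
have combE c : val (lin_comb b c) = psi (kappa (embed_row c)).
  rewrite /lin_comb /embed_row !linear_sum; apply: eq_bigr => j _.
  by rewrite !linearZ.
have psi0 c : psi (kappa c) = 0 <->
    forall i, exists x y, c 0 i = x * smith_divisor pi a i + y * pi.
  split=> [/psi_ker[h' h'E] i|h].
    have [c' c'E] := kappa_surj h'.
    have : kappa (c - pi *: c') = 0 by rewrite linearB linearZ /= c'E h'E subrr.
    move=> /kappa_ker/(_ i)[x]; rewrite !mxE => xE; exists x, (c' 0 i).
    by rewrite -xE; ring.
  have [f fP] := choice h; have [g gP] := choice fP.
  apply/psi_ker; exists (kappa (\row_i g i)).
  apply/eqP; rewrite -subr_eq0 -linearZ -linearB; apply/eqP/kappa_ker => i.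
  by exists (f i); rewrite !mxE gP; ring.
apply: (@killed_module_has_dim _ _ _ _ _ _ b) => [x|c c0 j].
  have [h [hk xE]] : exists h, pi ^+ k *: h = 0 /\ val x = psi h.
    by apply/N_im; exact: valP.
  have [c cE] := kappa_surj h.
  exists (\row_j c 0 (enum_val j)); apply: val_inj; rewrite combE xE -cE.
  apply/eqP; rewrite -subr_eq0 -!linearB; apply/eqP/psi0 => i; rewrite !mxE.
  have [iJ|iJ] := boolP (i \in J).
    rewrite -(enum_rankK_in iJ iJ) embed_rowE !mxE.
    by exists 0, 0; rewrite subrr !mul0r addr0.
  (* Outside [J], pi^k c_i is a multiple of delta_i. A free coordinate is therefore 0; if a_i = 0
     then delta_i = 1; if a_i > k then [pi] divides c_i. *)
  rewrite embed_row0 // subr0.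
  have := hk; rewrite -cE -linearZ => /kappa_ker/(_ i)[y]; rewrite mxE.
  move: iJ; rewrite inE /P /smith_divisor; case: ifP => /= [ia|_ _]; last first.
    move/eqP; rewrite mulr0 mulf_eq0 expf_eq0 (negPf pi_neq0) andbF /= => /eqP->.
    by exists 0, 0; rewrite !mul0r addr0.
  case: (posnP (nth 0%N a i)) => [-> _ _|a0 /=].
    by exists (c 0 i), 0; rewrite mulr1 mul0r addr0.
  rewrite -ltnNge => ka yE; exists 0, (y * pi ^+ (nth 0%N a i - k).-1).
  rewrite mul0r add0r -mulrA -exprSr prednK ?subn_gt0 //.
  have pk0 : pi ^+ k != 0 by rewrite expf_neq0.
  by apply: (mulfI pk0); rewrite yE mulrCA -exprD subnKC // ltnW.
(* On [J] the ideal (delta_i, pi) is (pi), because a_i >= 1. *)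
have /psi0/(_ (enum_val j)) : psi (kappa (embed_row c)) = 0 by rewrite -combE c0.
rewrite embed_rowE; have := enum_valP j; rewrite inE => /andP[ja /andP[j1 _]].
move=> [x [y ->]]; rewrite /smith_divisor ja.
exists (x * pi ^+ (nth 0%N a (enum_val j)).-1 + y).
by rewrite mulrDl -mulrA -exprSr prednK.
Qed.

Lemma presentation_torsion_summands :
  has_torsion_summands pi H (count (fun x => 1 <= x)%N a).
Proof.
pose J := [set i : 'I_m | (i < size a)%N && (0 < nth 0%N a i)%N].
pose J' := [set i : 'I_m | (size a <= i)%N].
rewrite -(card_count (fun x => 0 < x)%N size_a) -/J.
pose e (j : 'I_#|J|) := nth 0%N a (enum_val j).
exists #|J'|, e; split.
  by move=> j; have := enum_valP j; rewrite inE => /andP[].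
pose T := ('rV[R]_#|J'| * prodm (fun i => modpi pi (e i) R^o))%type.
(* A relation rather than a formula: [c] may be any lift, and its coordinates with a_i = 0 are
   arbitrary, since [kappa] kills them. *)
pose g (xy : T) (h : H) := exists c : 'rV[R]_m,
  [/\ forall j, xy.1 0 j = c 0 (enum_val j),
      forall j, (xy.2 : prodm _) j = quom_pi (multm R^o (pi ^+ e j)) (c 0 (enum_val j))
    & h = kappa c].
have pi0 (k : nat) (x : R) :
    quom_pi (multm R^o (pi ^+ k)) x = 0 <-> exists y, x = y * pi ^+ k.
  rewrite quom_pi_eq0; split=> [/asboolP[y ->]|[y ->]]; first by exists y; rewrite mulrC.
  by apply/asboolP; exists y; rewrite mulrC.
have gP : linear_graph g.
  split.
  - move=> [x y]; pose c := embed_row x + embed_row (\row_j repr ((y : prodm _) j)).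
    exists (kappa c), c; split=> // j; rewrite /c mxE /=.
      rewrite embed_rowE embed_row0 ?addr0 //.
      by have := enum_valP j; rewrite !inE leqNgt => /negPf->.
    rewrite embed_rowE embed_row0 ?add0r ?mxE ?quom_reprK //.
    by have := enum_valP j; rewrite !inE -ltnNge => /andP[].
  - move=> r [x y] [x' y'] h h' [c [/= xc yc ->]] [c' [/= xc' yc' ->]].
    exists (r *: c + c'); split=> [j|j|]; last by rewrite linearP.
      by rewrite !mxE xc xc'.
    transitivity (prodm_val (r *: y + y') j); first by [].
    rewrite prodm_linear yc yc' !mxE; exact/esym/linearP.
  - move=> h [c [/= xc yc ->]]; apply/kappa_ker => i; rewrite /smith_divisor.
    case: ifP => ia; last first.
      have iJ : i \in J' by rewrite inE leqNgt ia.
      by exists 0; rewrite -(enum_rankK_in iJ iJ) -xc mxE mul0r.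
    have [->|a0] := posnP (nth 0%N a i); first by exists (c 0 i); rewrite mulr1.
    have iJ : i \in J by rewrite inE ia.
    have := yc (enum_rank_in iJ i); rewrite prodm0E => /esym /pi0.
    by rewrite /e enum_rankK_in.
exists (graph_map gP); apply: inj_surj_bijective => [|h].
  apply: raddf_inj => -[x y] xy0.
  have [c [/= xc yc /esym]] := graph_funP gP (x, y).
  rewrite [graph_fun _ _]xy0 => /kappa_ker cE.
  congr pair.
    apply/rowP => j; rewrite xc mxE; have [z ->] := cE (enum_val j).
    have := enum_valP j; rewrite inE leqNgt /smith_divisor => /negPf->.
    by rewrite mulr0.
  apply: prodmP => j; rewrite yc prodm0E; apply/pi0.
  have [z ->] := cE (enum_val j); exists z.
  by have := enum_valP j; rewrite inE /smith_divisor /e => /andP[->].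
have [c cE] := kappa_surj h.
exists (\row_j c 0 (enum_val j),
        mkprodm (fun j => quom_pi (multm R^o (pi ^+ e j)) (c 0 (enum_val j)))).
by apply: graph_funE; exists c; split=> //= j; rewrite ?mxE ?mkprodmE.
Qed.

(** Representatives modulo pi^(k+1) are built digit by digit: the lowest digit runs over [q] lifts
    of the residue field, and the remaining part, divided by [pi], over representatives modulo
    pi^k. *)
Lemma residue_system q : ([set: residue_field hpi] #= `I_q)%card ->
  forall k, exists (T : finType) (rho : T -> R),
    [/\ #|T| = (q ^ k)%N,
        forall x, exists t y, x = rho t + y * pi ^+ k
      & forall t t' y, rho t - rho t' = y * pi ^+ k -> t = t'].
Proof.
move=> /card_set_bijP[f fbij] k.
have [fI fS] : injective f /\ forall i, (i < q)%N -> exists x, f x = i.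
  case: fbij => _ fI fS; split; first by move=> x y; apply: fI; rewrite inE.
  by move=> i iq; have [x _ <-] := fS i iq; exists x.
have fq x : (f x < q)%N by case: fbij => fq _ _; exact: fq.
have [g gP] := @choice 'I_q (residue hpi) (fun i x => f x = i)
  (fun i => fS i (ltn_ord i)).
elim: k => [|k [T [rho [Tk rhoS rhoI]]]].
  exists unit, (fun=> 0); split; first by rewrite card_unit.
    by move=> x; exists tt, x; rewrite add0r mulr1.
  by move=> [] [].
exists ('I_q * T)%type, (fun t => repr (g t.1) + rho t.2 * pi); split.
- by rewrite card_prod card_ord Tk expnS.
- move=> x; pose i := Ordinal (fq (residue_pi hpi x)).
  have giE : residue_pi hpi (repr (g i)) = residue_pi hpi x.
    by rewrite residue_reprK; apply: fI; rewrite gP.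
  have [z zE] := proj1 (residue_piE _ _ _) (esym giE).
  have [t [y yE]] := rhoS z; exists (i, t), y => /=.
  by rewrite exprSr -[LHS](subrK (repr (g i))) zE yE; ring.
- move=> [i t] [i' t'] y /= E.
  (* Modulo [pi] only the lowest digits remain, so they agree; then [pi] cancels. *)
  have ii' : i = i'.
    apply: val_inj; rewrite /= -[LHS]gP -[RHS]gP; congr f.
    rewrite -[LHS]residue_reprK -[RHS]residue_reprK; apply/residue_piE.
    exists (y * pi ^+ k - rho t + rho t').
    by rewrite !mulrDl -mulrA -exprSr -E; ring.
  rewrite ii' in E *; congr pair; apply: (rhoI _ _ y); apply: (mulIf pi_neq0).
  by rewrite -mulrA -exprSr -E; ring.
Qed.

(** A torsion class has zero free coordinates, so it amounts to one representative modulo pi^(a_i)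
    for each i < size a. *)
Lemma presentation_torsion_card q : ([set: residue_field hpi] #= `I_q)%card ->
  ([set: subm (torsm H)] #= `I_(q ^ \sum_(x <- a) x)%N)%card.
Proof.
move=> /residue_system sys.
pose d (i : 'I_m) := smith_divisor pi a i.
have dI (i : 'I_m) : exists p : {T : finType & T -> R},
    [/\ #|projT1 p| = (q ^ nth 0%N a i)%N,
        forall x, (i < size a)%N \/ x = 0 -> exists t y, x = projT2 p t + y * d i,
        forall t t' y, projT2 p t - projT2 p t' = y * d i -> t = t'
      & forall t, (i < size a)%N \/ projT2 p t = 0].
  rewrite /d /smith_divisor; case: (ltnP i (size a)) => ia.
    have [T [rho [Tk rS rI]]] := sys (nth 0%N a i).
    exists (existT (fun T : finType => T -> R) T rho).
    by split=> //= t; left.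
  (* A free coordinate gets the single representative 0; the default exponent 0 of [nth] matches its
     cardinal q^0 = 1. *)
  exists (existT (fun T : finType => T -> R) unit (fun=> 0)).
  split=> [|x [//|->]|[] []|t].
  - by rewrite card_unit nth_default.
  - by exists tt, 0; rewrite mul0r addr0.
  - by [].
  - by right.
have {dI} [p pP] := choice dI.
pose T i := projT1 (p i); pose rho i : T i -> R := projT2 (p i).
pose theta (f : {dffun forall i, T i}) : H := kappa (\row_i rho i (f i)).
have theta_tors f : theta f \in torsm H.
  (* The sum of all exponents is at least each a_i, so this single power kills every torsion
     summand. *)
  apply/asboolP; exists (pi ^+ \sum_(x <- a) x); split; first by rewrite expf_neq0.
  rewrite -linearZ; apply/kappa_ker => i; rewrite !mxE /smith_divisor.
  case: ifP => ia.
    exists (pi ^+ (\sum_(x <- a) x - nth 0%N a i) * rho i (f i)).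
    rewrite mulrAC -exprD subnK // (big_nth 0%N) big_mkord.
    by rewrite (bigD1 (Ordinal ia)) //= leq_addr.
  have [_ _ _ /(_ (f i))] := pP i; rewrite ia => -[//|fi0].
  by exists 0; rewrite /rho fi0 !mulr0.
pose Theta f : subm (torsm H) := exist (fun x => x \in torsm H) _ (theta_tors f).
have Theta_bij : bijective Theta.
  apply: inj_surj_bijective => [f g /(congr1 val) /= fg|[h hT]].
    apply/ffunP => i; have [_ _ + _] := pP i.
    have /eqP := fg; rewrite -subr_eq0 -linearB => /eqP/kappa_ker/(_ i)[y].
    by rewrite !mxE => yE /(_ _ _ _ yE).
  have /asboolP[s [s0 sh]] := hT; have [c cE] := kappa_surj h.
  have c0 (i : 'I_m) : (i < size a)%N \/ c 0 i = 0.
    case: (ltnP i (size a)) => ia; [by left|right].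
    move: sh; rewrite -cE -linearZ => /kappa_ker/(_ i)[y].
    rewrite mxE /smith_divisor ltnNge ia mulr0 => /eqP.
    by rewrite mulf_eq0 (negPf s0) => /eqP.
  have ex i : exists t, exists y, c 0 i = rho i t + y * d i.
    by have [_ + _ _] := pP i; apply.
  exists [ffun i => projT1 (cid (ex i))]; apply: val_inj; rewrite /= -cE.
  apply/eqP; rewrite -subr_eq0 -linearB; apply/eqP/kappa_ker => i.
  rewrite !mxE ffunE; case: (cid _) => t /= [y ->].
  by exists (- y); rewrite /d; ring.
have card_T : #|{dffun forall i, T i}| = (q ^ \sum_(x <- a) x)%N.
  rewrite card_dep_ffun foldrE big_map big_enum /=.
  rewrite (eq_bigr (fun i : 'I_m => q ^ nth 0 a i)%N); last by move=> i _; case: (pP i).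
  rewrite -(big_morph _ (expnD q) (expn0 q)); congr (q ^ _)%N.
  rewrite (big_nth 0%N) big_mkord (big_ord_widen m (fun i => nth 0 a i)%N) //.
  rewrite [RHS]big_mkcond; apply: eq_bigr => i _.
  by case: ltnP => // ia; rewrite nth_default.
rewrite -card_T; apply: card_eq_trans _ (card_esym card_II).
have [g Thetag gTheta] := Theta_bij.
have bij : bijective (fun x => enum_rank (g x)).
  exists (fun i => Theta (enum_val i)) => x /=; first by rewrite enum_rankK.
  by rewrite Thetag enum_valK.
have [s _] := PbijTT bij; exact: pcard_eq s.
Qed.

End Presentation.

(** * The image of the digit map *)

Lemma prodm_choice (R : pzRingType) (I : finType) (M : I -> lmodType R)
    (P : forall i, M i -> Prop) :
  (forall i, exists y, P i y) -> exists x : prodm M, forall i, P i (prodm_val x i).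
Proof.
move=> ex; exists (mkprodm (fun i => projT1 (cid (ex i)))) => i.
by rewrite mkprodmE; case: (cid _).
Qed.

Section Reduction.
Variables (R : idomainType) (pi : R) (G : graph) (o : orientation G).

Definition modpi_quot k (M : lmodType R) : {linear M -> modpi pi k M} :=
  quom_pi (multm M (pi ^+ k)).

Lemma modpi_quot_eq0 k (M : lmodType R) x :
  modpi_quot k M x = 0 <-> exists y, x = pi ^+ k *: y.
Proof. by rewrite quom_pi_eq0; split=> [/asboolP|h]; last exact/asboolP. Qed.

Lemma modpi_quot_natural k (M M' : lmodType R) (f : {linear M -> M'}) x :
  modpi_quot k M' (f x) = modpi_map pi k f (modpi_quot k M x).
Proof. by rewrite [RHS]quom_mapE. Qed.

Definition sheaf_quot k (F : sheaf R G) : sheaf_map F (mod_sheaf pi k F) :=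
  @SheafMap R G F (mod_sheaf pi k F)
    (fun v => modpi_quot k _) (fun e => modpi_quot k _)
    (fun e b => @modpi_quot_natural k _ _ (restriction F e b)).

Definition H1_reduce (F : sheaf R G) : {linear H1 o F -> H1 o (mod_sheaf pi 1 F)} :=
  H1_map o (sheaf_quot 1 F).

Lemma H1_reduceE F w :
  H1_reduce F (quom_pi _ w) = quom_pi _ (C1_map (sheaf_quot 1 F) w).
Proof. exact: quom_mapE. Qed.

Lemma C0_map_quot_surj k (F : sheaf R G) s : exists t, C0_map (sheaf_quot k F) t = s.
Proof.
exists (mkprodm (fun v => repr (prodm_val s v))).
by apply: prodmP => v; rewrite [LHS]mkprodmE /= mkprodmE [LHS]quom_reprK.
Qed.

Lemma C1_map_quot_eq0 k (F : sheaf R G) w :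
  C1_map (sheaf_quot k F) w = 0 <-> exists v, w = pi ^+ k *: v.
Proof.
split=> [w0|[v ->]].
  have ex e : exists y, prodm_val w e = pi ^+ k *: y.
    apply/modpi_quot_eq0.
    by have := congr1 (fun z => prodm_val z e) w0; rewrite [LHS]mkprodmE [RHS]mkprodmE.
  have [v vE] := prodm_choice ex.
  by exists v; apply: prodmP => e; rewrite [LHS]vE [RHS]mkprodmE.
apply: prodmP => e; rewrite [LHS]mkprodmE [RHS]mkprodmE; apply/modpi_quot_eq0.
by exists (prodm_val v e); rewrite [LHS]mkprodmE.
Qed.

(** Right exactness: if [w] is a coboundary modulo [pi], lift the 0-cochain to [t]; then w - d t
    vanishes modulo [pi], so it is pi v. *)
Lemma H1_reduce_eq0 (F : sheaf R G) h :
  H1_reduce F h = 0 <-> exists h', h = pi *: h'.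
Proof.
split=> [|[h' ->]]; last by rewrite linearZ; exact: H1_mod1_killed.
rewrite -(quom_reprK h) H1_reduceE; move: (repr h) => w.
move/quom_pi_eq0 => /asboolP[s sE]; have [t tE] := C0_map_quot_surj s.
have /C1_map_quot_eq0[v vE] : C1_map (sheaf_quot 1 F) (w - coboundary o F t) = 0.
  by rewrite linearB C1_map_coboundary tE sE subrr.
exists (quom_pi _ v); rewrite -linearZ; apply/quom_piE.
apply/asboolP; exists t; apply/eqP; rewrite subr_eq addrC -subr_eq; exact/eqP.
Qed.

(** Lifted to [F], the snake lemma is an equation d t = pi^k w: the digit map sends the class of [t]
    modulo pi^k to the class of [w] modulo [pi], and the equation says that pi^k kills the class of
    [w]. *)
Lemma imm_digit_map (hR : is_DVR R) (hpi : uniformizer pi) (F : sheaf R G)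
    (hF : free_stalks F) k q :
  q \in imm (digit_map hR hpi o hF k) <->
  exists h, pi ^+ k *: h = 0 /\ q = H1_reduce F h.
Proof.
set pi0 := uniformizer_neq0 hR hpi.
split=> [/asboolP[s ->]|[h [hk ->]]].
  have [t [u [ts us sE]]] :=
    graph_funP (connecting_graphP o (digit_short_exact pi k F)) s.
  (* [t] lifts [s] to F/pi^(k+1); [t'] lifts it further, to [F]. *)
  have [t' t'E] := C0_map_quot_surj t.
  have ex e : exists w, prodm_val (coboundary o F t') e = pi ^+ k *: w /\
      emap (sheaf_digit_iso k pi0 hF) e (prodm_val u e) = modpi_quot 1 _ w.
    have [x [y [yE uE rE]]] := graph_funP
      (digit_graphP k pi0 (free_torsion_free (free_estalk hF e))) (prodm_val u e).
    have := congr1 (fun z => prodm_val z e) us.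
    rewrite -t'E -C1_map_coboundary [LHS]mkprodmE [RHS]mkprodmE uE.
    rewrite [LHS]grpi_inclE yE => /quom_piE /asboolP[z zE].
    (* pi^k x is d t' at [e] only up to pi^(k+1) z; subtracting pi z makes the equation exact in [F]
       and keeps the class modulo [pi]. *)
    exists (x - pi *: z); split.
      by rewrite scalerBr scalerA -exprSr -zE opprB addrC subrK.
    rewrite -uE; apply: etrans rE _; apply/quom_piE; rewrite opprB addrC subrK.
    by apply/asboolP; exists z.
  have [w wP] := prodm_choice ex; exists (quom_pi _ (w : C1 F)); split.
    rewrite -linearZ; apply/quom_pi_eq0/asboolP; exists t'.
    by apply: prodmP => e; rewrite [LHS]mkprodmE; have [<-] := wP e.
  rewrite H1_reduceE /= [graph_fun _ _]sE [LHS]quom_mapE; congr quom_pi.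
  apply: prodmP => e; rewrite [LHS]mkprodmE [RHS]mkprodmE.
  by have [_] := wP e.
move: hk; rewrite -(quom_reprK h); move: (repr h) => w.
rewrite -linearZ => /quom_pi_eq0 /asboolP[t tE]; apply/asboolP.
(* Since d t = pi^k w, the reduction of [t] is a cocycle modulo pi^k. *)
have s0 : C0_map (sheaf_quot k F) t \in kerm (coboundary o (mod_sheaf pi k F)).
  rewrite inE -C1_map_coboundary -tE; apply/eqP/C1_map_quot_eq0.
  by exists w.
pose s : H0 o (mod_sheaf pi k F) := exist (fun x => x \in kerm _) _ s0.
have mult_pi e : pi ^+ k *: prodm_val w e \in multm (estalk F e) (pi ^+ k).
  by apply/asboolP; exists (prodm_val w e).
pose y e : subm (multm (estalk F e) (pi ^+ k)) :=
  exist (fun x => x \in multm _ _) _ (mult_pi e).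
pose u : C1 (gr_sheaf pi k F) := mkprodm (fun e => quom_pi _ (y e)).
exists s; rewrite /digit_map /=.
have -> : graph_fun (connecting_graphP o (digit_short_exact pi k F)) s = quom_pi _ u.
  (* The lift of [s] may be taken to be [t] modulo pi^(k+1), whose coboundary is the class of pi^k
     w. *)
  apply: graph_funE; exists (C0_map (sheaf_quot k.+1 F) t), u; split=> //.
    apply: prodmP => v; rewrite [LHS]mkprodmE [RHS]mkprodmE mkprodmE.
    exact: modpi_projE.
  rewrite -C1_map_coboundary -tE; apply: prodmP => e.
  rewrite [LHS]mkprodmE [RHS]mkprodmE mkprodmE [LHS]grpi_inclE.
  by congr quom_pi; rewrite [RHS]mkprodmE.
rewrite [LHS]H1_reduceE [RHS]quom_mapE; congr quom_pi.
apply: prodmP => e; rewrite [LHS]mkprodmE [RHS]mkprodmE mkprodmE.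
apply/esym/graph_funE; exists (prodm_val w e), (y e); split=> //.
Qed.

End Reduction.

(** * From the matrix of the coboundary to the theorem *)

Lemma cokernel_presentation (R : idomainType) (pi : R) (M N : lmodType R)
    (d : {linear M -> N}) n m (b0 : 'I_n -> M) (b1 : 'I_m -> N)
    (A : 'M[R]_(m, n)) U V a :
  is_basis b0 -> is_basis b1 ->
  (forall j, d (b0 j) = \sum_(i < m) A i j *: b1 i) ->
  U \in unitmx -> V \in unitmx -> U *m A *m V = smith_mx pi a m n ->
  (size a <= n)%N ->
  exists kappa : {linear 'rV[R]_m -> quom (imm d)},
    (forall h, exists c, kappa c = h) /\
    forall c, kappa c = 0 <-> forall i, exists y, c 0 i = y * smith_divisor pi a i.
Proof.
move=> [f0 _ K0] b1_bij hA uU uV UAV an; have [f1 K1 K1'] := b1_bij.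
(* The coordinates [c] refer to the basis of [N] changed by [U]; there the image of [d] is that of
   the Smith matrix, and [V] only reparametrizes the source. *)
pose kappa : {linear _ -> _} :=
  quom_pi (imm d) \o (lin_comb b1 \o mulmxr (invmx U)^T).
exists kappa; split=> [h|c].
  exists (f1 (repr h) *m U^T); rewrite /= -mulmxA -trmx_mul mulVmx // trmx1 mulmx1.
  by rewrite [lin_comb _ _]K1' quom_reprK.
rewrite -(smith_image pi c an) -UAV !trmx_mul; split.
  rewrite /kappa /= => /quom_pi_eq0/asboolP[t tE].
  exists (f0 t *m (invmx V)^T).
  have {}tE : c *m (invmx U)^T = f0 t *m A^T.
    apply: (bij_inj b1_bij).
    rewrite -[LHS]/(lin_comb b1 _) -[RHS]/(lin_comb b1 _) tE -(lin_combM _ hA).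
    by rewrite [lin_comb b0 _]K0.
  rewrite !mulmxA -(mulmxA (f0 t)) -(trmx_mul V) mulmxV // trmx1 mulmx1.
  by rewrite -tE -mulmxA -trmx_mul mulmxV // trmx1 mulmx1.
move=> [x ->]; apply/quom_pi_eq0/asboolP; exists (lin_comb b0 (x *m V^T)).
rewrite (lin_combM _ hA) /= -!mulmxA -trmx_mul mulVmx // trmx1 mulmx1.
by rewrite !mulmxA.
Qed.

Theorem theoremA (R : idomainType) (pi : R)
    (hR : is_DVR R) (hpi : uniformizer pi)
    (G : graph) (o : orientation G) (F : sheaf R G) (hF : free_stalks F)
    (n m : nat) (b0 : 'I_n -> C0 F) (b1 : 'I_m -> C1 F)
    (hb0 : is_basis b0) (hb1 : is_basis b1)
    (A : 'M[R]_(m, n))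
    (hA : forall j, coboundary o F (b0 j) = \sum_(i < m) A i j *: b1 i) :
  let D := fun k => dimension (im_digit hR hpi o hF k) in
  exists a : seq nat,
    (exists (U : 'M[R]_m) (V : 'M[R]_n),
       [/\ U \in unitmx, V \in unitmx & U *m A *m V = smith_mx pi a m n]) /\
    sorted leq a /\
    size a = matrix_rank A /\
    (forall k, finite_dim (im_digit hR hpi o hF k) /\
               D k = count (fun x => 1 <= x <= k)%N a) /\
    {homo D : k l / (k <= l)%N} /\
    (exists K, forall k, (K <= k)%N -> D k = count (fun x => 1 <= x)%N a) /\
    has_torsion_summands pi (H1 o F) (count (fun x => 1 <= x)%N a) /\
    (forall l, (1 <= l)%N ->
       (count_mem l a)%:Z = (D l)%:Z - (D l.-1)%:Z) /\
    (forall q : nat, ([set: residue_field hpi] #= `I_q)%card ->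
       ([set: subm (torsm (H1 o F))] #= `I_(q ^ \sum_(x <- a) x)%N)%card).
Proof.
move=> D; have [a [sa za UAV]] := smith_form hR hpi A.
have [am an] : (size a <= m)%N /\ (size a <= n)%N.
  by apply/andP; rewrite -leq_min.
have [kappa [kS kK]] : exists kappa : {linear 'rV[R]_m -> H1 o F},
    (forall h, exists c, kappa c = h) /\
    forall c, kappa c = 0 <-> forall i, exists y, c 0 i = y * smith_divisor pi a i.
  have [U [V [uU uV E]]] := UAV.
  exact: cokernel_presentation hb0 hb1 hA uU uV E an.
have dimD k : has_dim (im_digit hR hpi o hF k) (count (fun x => 1 <= x <= k)%N a).
  (* Here [psi] is the reduction of H^1(F) to H^1(F/pi), and [N] is the image of the digit map. *)
  apply: (@presentation_digit_dim _ _ hR hpi _ _ kappa _ am kS kK _ (H1_reduce pi o F)).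
    exact: H1_reduce_eq0.
  by move=> q; exact: imm_digit_map.
have DE k : D k = count (fun x => 1 <= x <= k)%N a := dimension_eq (dimD k).
exists a; split=> //; split=> //.
split; last split; last split; last split; last split; last split.
- by rewrite (matrix_rank_equiv UAV) (smith_mx_rank hR hpi za).
- by move=> k; split=> //; exists (count (fun x => 1 <= x <= k)%N a); exact: dimD.
- move=> k l kl; rewrite !DE; apply: sub_count => x /andP[-> xk] /=.
  exact: leq_trans kl.
(* From the largest exponent on, the bound x <= k excludes nothing. *)
- exists (\max_(x <- a) x) => k ak; rewrite DE; apply: eq_in_count => x xa.
  by rewrite (leq_trans _ ak) ?andbT // leq_bigmax_seq.
- exact: presentation_torsion_summands kK.
- move=> l l1; rewrite !DE.
  (* The interval from 1 to l is the one to l - 1 with l adjoined, which needs 1 <= l. *)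
  have -> : count (fun x => 1 <= x <= l)%N a =
      (count_mem l a + count (fun x => 1 <= x <= l.-1)%N a)%N.
    rewrite -count_predUI [count (predI _ _) _](eq_count (a2 := pred0)) ?count_pred0.
      rewrite addn0; apply: eq_count => x /=; lia.
    move=> x /=; lia.
  by rewrite PoszD addrK.
- by move=> q qE; exact: (presentation_torsion_card hR am kS kK qE).
Qed.
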